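(* Let $P$ be a binary matrix (pattern). The class $\mathrm{Av}(P)$ is row-bounded if and only if $P$ does not contain any of $Q_1,Q_2,Q_3,Q_4$ as an interval minor, where $Q_1,\dots,Q_4\in\{0,1\}^{3\times3}$ are the permutation matrices with $\mathrm{supp}(Q_1)=\{(1,2),(2,1),(3,3)\}$, $\mathrm{supp}(Q_2)=\{(1,2),(2,3),(3,1)\}$, $\mathrm{supp}(Q_3)=\{(1,1),(2,3),(3,2)\}$, $\mathrm{supp}(Q_4)=\{(1,3),(2,1),(3,2)\}$.
   Context: All matrices are binary. For $M\in\{0,1\}^{m\times n}$, rows are numbered $1,\dots,m$ top to bottom and columns $1,\dots,n$ left to right; $(i,j)$ is the entry in row $i$, column $j$; it is a 1-entry if $M(i,j)=1$ and a 0-entry otherwise; $\mathrm{supp}(M)$ is the set of 1-entries. For integers, $[a,b]=\{a,\dots,b\}$, $(a,b]=[a+1,b]$, $[n]=[1,n]$, and $M[R\times C]$ denotes the submatrix on row set $R$ and column set $C$. A pattern $P\in\{0,1\}^{k\times\ell}$ is an interval minor of $M\in\{0,1\}^{m\times n}$ (written $P\preccurlyeq M$; $M$ contains $P$) if there are integers $0=r_0<r_1<\dots<r_k=m$ and $0=c_0<c_1<\dots<c_\ell=n$ such that for each 1-entry $(i,j)$ of $P$ the submatrix $M[(r_{i-1},r_i]\times(c_{j-1},c_j]]$ contains a 1-entry; otherwise $M$ avoids $P$. $\mathrm{Av}(P)$ is the set of all binary matrices avoiding $P$. A matrix $M$ in a set $\mathcal C$ of matrices is critical for $\mathcal C$ if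 changing any single 0-entry of $M$ into a 1-entry yields a matrix not in $\mathcal C$. A horizontal 0-run of $M$ is a maximal set of consecutive 0-entries within one row; the complexity of a row is the number of horizontal 0-runs in it. The row-complexity of $\mathcal C$ is the supremum, over all matrices critical for $\mathcal C$, of the maximum complexity of a row of the matrix; $\mathcal C$ is row-bounded if this is finite. *)

(* Defs.v *)
(* Binary matrices are 'M[bool]_(m, n); rows/columns are
   0-indexed ordinals (paper row i+1 = ordinal i). *)
From mathcomp Require Import all_boot matrix.
Set Implicit Arguments. Unset Strict Implicit. Unset Printing Implicit Defensive.

(* P (k x l) is an interval minor of M (m x n): there are
   0 = r_0 < r_1 < ... < r_k = m and 0 = c_0 < ... < c_l = n such that for
   every 1-entry (i,j) of P (0-indexed) the block with rows (r_i, r_{i+1}]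
   and columns (c_j, c_{j+1}] (1-indexed), i.e. 0-indexed rows a with
   r_i <= a < r_{i+1}, contains a 1-entry of M. *)
Definition interval_minor k l m n (P : 'M[bool]_(k, l)) (M : 'M[bool]_(m, n)) : Prop :=
  exists (r c : nat -> nat),
    [/\ r 0 = 0, r k = m & (forall i, i < k -> r i < r i.+1)] /\
    [/\ c 0 = 0, c l = n & (forall j, j < l -> c j < c j.+1)] /\
        forall (i : 'I_k) (j : 'I_l), P i j ->
          exists (a : 'I_m) (b : 'I_n),
            [/\ r i <= a < r i.+1, c j <= b < c j.+1 & M a b].

Definition avoids k l m n (P : 'M[bool]_(k, l)) (M : 'M[bool]_(m, n)) : Prop :=
  ~ interval_minor P M.

Definition set_one m n (M : 'M[bool]_(m, n)) (a : 'I_m) (b : 'I_n) : 'M[bool]_(m, n) :=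
  \matrix_(i, j) (M i j || ((i == a) && (j == b))).

Definition critical k l m n (P : 'M[bool]_(k, l)) (M : 'M[bool]_(m, n)) : Prop :=
  avoids P M /\
  forall (a : 'I_m) (b : 'I_n), M a b = false -> ~ avoids P (set_one M a b).

(* Complexity of row i: number of horizontal 0-runs, counted by their first
   entries (a 0-entry that is in column 0 or preceded by a 1-entry). *)
Definition row_complexity m n (M : 'M[bool]_(m, n)) (i : 'I_m) : nat :=
  #|[set j : 'I_n | ~~ M i j &&
      ((val j == 0) || [exists j' : 'I_n, (val j' == (val j).-1) && M i j'])]|.

Definition row_bounded k l (P : 'M[bool]_(k, l)) : Prop :=
  exists B : nat, forall m n (M : 'M[bool]_(m, n)),
    critical P M -> forall i : 'I_m, row_complexity M i <= B.

Definition perm3 (s0 s1 s2 : nat) : 'M[bool]_(3, 3) :=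
  \matrix_(i, j) [|| (val i == 0) && (val j == s0),
                     (val i == 1) && (val j == s1) |
                     (val i == 2) && (val j == s2)].

(* supp Q1 = {(1,2),(2,1),(3,3)} etc. (1-indexed in the paper). *)
Definition Q1 := perm3 1 0 2.
Definition Q2 := perm3 1 2 0.
Definition Q3 := perm3 0 2 1.
Definition Q4 := perm3 2 0 1.

(* Main.v *)
(* Flipping a 0-entry of a critical matrix M to 1 creates a copy of P in which
   some point s of P is sent to this entry.

   If P avoids Q1, ..., Q4, then any three points of P in distinct rows and
   distinct columns form a monotone sequence. If a row of M has many 0-runs, then
   many of them have copies with the same s = (rho, gam), and unless the points of
   row rho can be shifted onto nearby 1-entries of the row of M, each copy has,
   close to the flipped entry, points of P outside row rho on both sides of
   column gam. The points left of column gam taken from one such copy, the points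
   right of it from a later copy, and row rho placed on 1-entries of the row of M
   then glue to a copy of P in M; monotonicity of triples tells where to take the
   points of column gam from. If the columns of row rho interleave with those of
   the other points so that this fails, P has only two nonempty rows, and these fit
   into the row of M and the alternating points close to the flipped entries.

   Conversely, let P have points a, b, c forming Q1. Copies of the rows of P
   strictly below a, up to c, are arranged along a rising staircase below a row of
   1-entries that misses one entry per copy. Since b is above and left of c, both
   lie in one step of the staircase, which leaves for a only the missing entry, and
   filling this entry completes a copy of P. The other Q's are mirror images. *)

From Stdlib Require Import Classical.
Require Import Defs.
From mathcomp Require Import all_boot matrix.
From mathcomp Require Import zify.
Set Implicit Arguments. Unset Strict Implicit. Unset Printing Implicit Defensive.

(** * Patterns with monotone triples *)

(** Interval minors in terms of the images of single points. The inequalities, written without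
    subtraction, leave room for all rows and columns of the pattern in between, empty ones included,
    so that cuts can be inserted afterwards. *)
Definition emb (k l m n : nat) (p q : nat -> nat -> bool)
    (f g : nat -> nat -> nat) : Prop :=
  forall i j, p i j ->
    [/\ q (f i j) (g i j), i <= f i j /\ f i j + k <= m + i
      & j <= g i j /\ g i j + l <= n + j] /\
    forall i' j', p i' j' ->
      (i < i' -> f i j + i' <= f i' j' + i) /\
      (j < j' -> g i j + j' <= g i' j' + j).

(** The patterns [Q1] to [Q4] are exactly the non-monotone permutations of three points. *)
Definition monotone_triples (p : nat -> nat -> bool) : Prop :=
  forall i1 j1 i2 j2 i3 j3, p i1 j1 -> p i2 j2 -> p i3 j3 ->
    i1 < i2 -> i2 < i3 -> j1 != j2 -> j2 != j3 -> j1 != j3 ->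
    (j1 < j2 /\ j2 < j3) \/ (j3 < j2 /\ j2 < j1).

Section Shape.

Variable p : nat -> nat -> bool.
Hypothesis mono : monotone_triples p.

(** In a monotone triple the orders by rows and by columns agree up to reversal, so both have the
    same middle point. *)
Lemma triple_between ia ja ib jb ic jc : p ia ja -> p ib jb -> p ic jc ->
  ja < jb -> jb < jc ->
  ia = ib \/ ib = ic \/ ia = ic \/ (ia < ib /\ ib < ic) \/ (ic < ib /\ ib < ia).
Proof.
move=> pa pb pc ab bc.
case: (ltngtP ia ib) => [h12|h12|]; case: (ltngtP ib ic) => [h23|h23|];
case: (ltngtP ia ic) => [h13|h13|] *; try lia; exfalso.
all: try (have := mono pa pb pc h12 h23; lia).
all: try (have := mono pa pc pb h13 h23; lia).
all: try (have := mono pb pa pc h12 h13; lia).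
all: try (have := mono pb pc pa h23 h13; lia).
all: try (have := mono pc pa pb h13 h12; lia).
all: lia.
Qed.

Ltac lt_chain := solve [assumption | eauto 3 using ltn_trans with nocore].

(** All column orders of the three points are tried; nothing is added if none can be established. *)
Ltac pose_between A B C :=
  first [ have := triple_between A B C ltac:(lt_chain) ltac:(lt_chain)
        | have := triple_between A C B ltac:(lt_chain) ltac:(lt_chain)
        | have := triple_between B A C ltac:(lt_chain) ltac:(lt_chain)
        | have := triple_between B C A ltac:(lt_chain) ltac:(lt_chain)
        | have := triple_between C A B ltac:(lt_chain) ltac:(lt_chain)
        | have := triple_between C B A ltac:(lt_chain) ltac:(lt_chain) | idtac ].

Variables (rho gam rL gL rR gR : nat).
Hypotheses (ps : p rho gam) (pL : p rL gL) (pR : p rR gR).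
Hypotheses (rhoL : rL != rho) (rhoR : rR != rho) (ltL : gL < gam) (ltR : gam < gR).

Definition same_side i i' := (i < rho /\ i' < rho) \/ (rho < i /\ rho < i').

Lemma same_side_sym i i' : same_side i i' -> same_side i' i.
Proof. by case=> [[]|[]]; [left | right]. Qed.

Lemma same_side_trans i i' i'' :
  same_side i i' -> same_side i' i'' -> same_side i i''.
Proof. by clear; rewrite /same_side; lia. Qed.

Lemma same_side_neq i i' : same_side i i' -> i <> rho.
Proof. by clear; rewrite /same_side; lia. Qed.

(** Otherwise the two points and [(rho, gam)], the middle one by columns but not by rows, violate
    monotonicity. *)
Lemma left_right_same_row i j i' j' :
  p i j -> p i' j' -> j < gam -> gam < j' -> same_side i i' -> i = i'.
Proof.
move=> pa pc ja jc; have := triple_between pa ps pc ja jc.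
by clear; rewrite /same_side; lia.
Qed.

(** A point of row [rho] is separated from column [gam] by the column of a point of another row.
    This is the interleaving that leaves only two nonempty rows. *)
Definition crossL := exists j i' j',
  [/\ p rho j, p i' j', i' != rho & j < j' < gam].
Definition crossR := exists j i' j',
  [/\ p rho j, p i' j', i' != rho & gam < j' < j].

(** The separating point must lie in row [rR]. The rows of four points then alternate between [rho]
    and [rR] from left to right, and a point in a third row forms a non-monotone triple with two of
    them. *)
Lemma crossL_two_rows : crossL -> forall i j, p i j -> i = rho \/ i = rR.
Proof.
move=> [jw [iz [jz [pw pz niz /andP[jwz jz_gam]]]]] i j pij.
have E : iz = rR.
  have := triple_between pz ps pR jz_gam ltR.
  by have := triple_between pw pz pR jwz (ltn_trans jz_gam ltR); lia.
subst iz.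
case: (eqVneq i rho) => [->|ni]; first by left.
case: (eqVneq i rR) => [->|niR]; first by right.
case: (ltngtP j jw) => hw; case: (ltngtP j jz) => hz; case: (ltngtP j gam) => hg;
case: (ltngtP j gR) => hR; try (clear -hw hz hg hR ltL ltR jwz jz_gam; lia).
all: pose_between pw pz pij; pose_between ps pz pij;
  pose_between pw pR pij; pose_between ps pR pij;
  clear -ni niR niz; lia.
Qed.

Lemma crossR_two_rows : crossR -> forall i j, p i j -> i = rho \/ i = rL.
Proof.
move=> [jw [iz [jz [pw pz niz /andP[gam_jz jzw]]]]] i j pij.
have E : iz = rL.
  have := triple_between pL ps pz ltL gam_jz.
  by have := triple_between pL pz pw (ltn_trans ltL gam_jz) jzw; lia.
subst iz.
case: (eqVneq i rho) => [->|ni]; first by left.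
case: (eqVneq i rL) => [->|niL]; first by right.
case: (ltngtP j jw) => hw; case: (ltngtP j jz) => hz; case: (ltngtP j gam) => hg;
case: (ltngtP j gL) => hL; try (clear -hw hz hg hL ltL ltR gam_jz jzw; lia).
all: pose_between pw pz pij; pose_between ps pz pij;
  pose_between pw pL pij; pose_between ps pL pij;
  clear -ni niL niz; lia.
Qed.

(** The cases of the gluing. Alignment leaves no column order to respect between row [rho] and the
    other points on one side of column [gam]; [flat], [freeL] and [freeR] restrict the points that
    share a side of row [rho] with a point of column [gam]. *)
Definition alignedL := forall j i' j',
  p rho j -> p i' j' -> i' != rho -> j < gam -> j' < gam -> j = j'.
Definition alignedR := forall j i' j',
  p rho j -> p i' j' -> i' != rho -> gam < j -> gam < j' -> j = j'.
Definition flat := forall i i' j',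
  p i gam -> p i' j' -> same_side i i' -> i = i'.
Definition freeL := forall i i' j',
  p i gam -> p i' j' -> same_side i i' -> gam <= j'.
Definition freeR := forall i i' j',
  p i gam -> p i' j' -> same_side i i' -> j' <= gam.

(** The point [(rho, jw)] forces all points of column [gam] off row [rho] to the side of [rR]. If
    that side also had a point left of [gam], it would consist of row [rR] alone, against
    [iq <> i']. *)
Lemma gapL_freeL jw iz jz iq i' j' : ~ crossL ->
  p rho jw -> p iz jz -> iz != rho -> jz < jw -> jw < gam ->
  p iq gam -> p i' j' -> same_side iq i' -> iq <> i' ->
  freeL.
Proof.
move=> nc pw pz niz zw wg pq pq' ss nq.
have H2 j1 i1 : p i1 j1 -> i1 != rho -> j1 < gam -> j1 <= jw.
  move=> b c e; rewrite leqNgt; apply/negP => f.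
  by apply: nc; exists jw, i1, j1; rewrite f e.
have sideR v : p v gam -> v <> rho -> same_side v rR.
  move=> pv nv; have := triple_between pw pv pR wg ltR.
  by have nR := rhoR; clear -nv nR; rewrite /same_side; lia.
move=> v ia ja pv pa sva; rewrite leqNgt; apply/negP => jag.
have sqR := sideR _ pq (same_side_neq ss).
have svR := sideR _ pv (same_side_neq sva).
have Ea : ia = rR.
  exact: (left_right_same_row pa pR jag ltR (same_side_trans (same_side_sym sva) svR)).
subst ia.
(* If [t] were another row, the points of row [rR] left of [gam] would all lie in column [jw]. The
   triples with [(rho, jw)] and with [(iz, jz)] would then put [t] both between [rho] and [rR] and
   beyond [rR]. *)
have keyV t : p t gam -> same_side t rR -> t = rR.
  move=> pt st; apply: NNPP => nt.
  have flush b : p rR b -> b < gam -> b = jw.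
    move=> pb bg; have := H2 _ _ pb rhoR bg; rewrite leq_eqVlt => /orP[/eqP|lt] //.
    have := triple_between pb pw pt lt wg.
    by clear -st nt; move: st; rewrite /same_side; lia.
  have Eja := flush _ pa jag; subst ja.
  have szn : ~ same_side iz rR.
    move=> sz; have E := left_right_same_row pz pR (ltn_trans zw wg) ltR sz.
    subst iz; have E := flush _ pz (ltn_trans zw wg).
    by clear -E zw; lia.
  have := triple_between pw pt pR wg ltR.
  have := triple_between pz pa pt zw wg.
  by clear -st szn niz nt; move: st szn niz nt; rewrite /same_side; lia.
have Eq := keyV _ pq sqR; subst iq.
case: (ltngtP j' gam) => [lt|gt|E].
- by apply: nq; apply: (esym (left_right_same_row pq' pR lt ltR (same_side_sym ss))).
- by apply: nq; apply: (left_right_same_row pa pq' jag gt ss).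
- by subst j'; apply: nq; apply: esym; apply: keyV => //; apply: same_side_sym.
Qed.

(** Mirror image of [gapL_freeL] under reversal of the columns. *)
Lemma gapR_freeR jw iz jz iq i' j' : ~ crossR ->
  p rho jw -> p iz jz -> iz != rho -> jw < jz -> gam < jw ->
  p iq gam -> p i' j' -> same_side iq i' -> iq <> i' ->
  freeR.
Proof.
move=> nc pw pz niz zw wg pq pq' ss nq.
have H2 j1 i1 : p i1 j1 -> i1 != rho -> gam < j1 -> jw <= j1.
  move=> b c e; rewrite leqNgt; apply/negP => f.
  by apply: nc; exists jw, i1, j1; rewrite f e.
have sideL v : p v gam -> v <> rho -> same_side v rL.
  move=> pv nv; have := triple_between pL pv pw ltL wg.
  by have nL := rhoL; clear -nv nL; rewrite /same_side; lia.
move=> v ia ja pv pa sva; rewrite leqNgt; apply/negP => jag.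
have sqL := sideL _ pq (same_side_neq ss).
have svL := sideL _ pv (same_side_neq sva).
have Ea : ia = rL.
  exact: (esym (left_right_same_row pL pa ltL jag (same_side_sym (same_side_trans (same_side_sym sva) svL)))).
subst ia.
have keyV t : p t gam -> same_side t rL -> t = rL.
  move=> pt st; apply: NNPP => nt.
  have flush b : p rL b -> gam < b -> b = jw.
    move=> pb bg; have := H2 _ _ pb rhoL bg; rewrite leq_eqVlt => /orP[/eqP|lt] //.
    have := triple_between pt pw pb wg lt.
    by clear -st nt; move: st; rewrite /same_side; lia.
  have Eja := flush _ pa jag; subst ja.
  have szn : ~ same_side iz rL.
    move=> sz; have E := esym (left_right_same_row pL pz ltL (ltn_trans wg zw) (same_side_sym sz)).
    subst iz; have E := flush _ pz (ltn_trans wg zw).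
    by clear -E zw; lia.
  have := triple_between pL pt pw ltL wg.
  have := triple_between pt pa pz wg zw.
  by clear -st szn niz nt; move: st szn niz nt; rewrite /same_side; lia.
have Eq := keyV _ pq sqL; subst iq.
case: (ltngtP j' gam) => [lt|gt|E].
- by apply: nq; apply: (esym (left_right_same_row pq' pa lt jag (same_side_sym ss))).
- by apply: nq; apply: (left_right_same_row pL pq' ltL gt ss).
- by subst j'; apply: nq; apply: esym; apply: keyV => //; apply: same_side_sym.
Qed.

(** If [flat] and one alignment fail, the absence of crossings leaves a point of another row beyond
    one of row [rho], and [gapL_freeL] or [gapR_freeR] applies. In the case [freeR], a point of row
    [rho] left of [gam] would put [rR] on the side of [iq], against [freeR]; the case [freeL] is
    symmetric. *)
Lemma uncrossed_shape : ~ crossL -> ~ crossR ->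
  [\/ alignedL /\ alignedR, flat,
      freeL /\ (forall j, p rho j -> j <= gam) |
      freeR /\ (forall j, p rho j -> gam <= j)].
Proof.
move=> nL nR.
case: (classic flat) => [?|nf]; first exact: Or42.
have [iq [i' [j' [pq pq' ss nq]]]] :
    exists iq i' j', [/\ p iq gam, p i' j', same_side iq i' & iq <> i'].
  apply: NNPP => H; apply: nf => a b c pa pb s.
  by apply: NNPP => nab; apply: H; exists a, b, c.
have nrho := same_side_neq ss.
case: (classic alignedL) => [aL|naL].
  case: (classic alignedR) => [aR|naR]; first exact: Or41.
  have [jw [iz [jz [pw pz niz [wg zw]]]]] : exists jw iz jz,
      [/\ p rho jw, p iz jz, iz != rho & gam < jw /\ jw < jz].
    apply: NNPP => H; apply: naR => a b c pa pb nb ag cg.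
    case: (ltngtP a c) => // ac; first by case: H; exists a, b, c.
    by case: nR; exists a, b, c; rewrite ac cg.
  have fr := gapR_freeR nR pw pz niz zw wg pq pq' ss nq.
  apply: Or44; split=> // j pj; rewrite leqNgt; apply/negP => jg.
  have sR : same_side iq rR.
    have := triple_between pj pq pR jg ltR.
    by have nR' := rhoR; clear -nrho nR'; rewrite /same_side; lia.
  by have := fr _ _ _ pq pR sR; rewrite leqNgt ltR.
have [jw [iz [jz [pw pz niz [wg zw]]]]] : exists jw iz jz,
    [/\ p rho jw, p iz jz, iz != rho & jw < gam /\ jz < jw].
  apply: NNPP => H; apply: naL => a b c pa pb nb ag cg.
  case: (ltngtP a c) => // ac; last by case: H; exists a, b, c.
  by case: nL; exists a, b, c; rewrite ac cg.
have fl := gapL_freeL nL pw pz niz zw wg pq pq' ss nq.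
apply: Or43; split=> // j pj; rewrite leqNgt; apply/negP => jg.
have sL : same_side iq rL.
  have := triple_between pL pq pj ltL jg.
  by have nL' := rhoL; clear -nrho nL'; rewrite /same_side; lia.
by have := fl _ _ _ pq pL sL; rewrite leqNgt ltL.
Qed.

End Shape.

(** * Gluing copies *)

Section Gluing.

Variables (k l m n : nat) (p q : nat -> nat -> bool).
Hypothesis p_bound : forall i j, p i j -> i < k /\ j < l.
Hypothesis mono : monotone_triples p.
Variables (i0 rho gam rL gL rR gR : nat).
Hypotheses (ps : p rho gam) (pL : p rL gL) (pR : p rR gR).
Hypotheses (rhoL : rL != rho) (rhoR : rR != rho) (ltL : gL < gam) (ltR : gam < gR).
(* Copy [x] sends the point (i, j) to (F x i j, G x i j), with the rows cut at
   [R x]; the [O x j] are 1-entries of row [i0] between the copies [x.-1] and [x]. *)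
Variables (F G : nat -> nat -> nat -> nat) (R O : nat -> nat -> nat).
Hypothesis Fs : forall x, x <= l -> F x rho gam = i0.
Hypothesis FGq : forall x i j, x <= l -> p i j -> i != rho \/ j != gam ->
  q (F x i j) (G x i j).
Hypothesis F_bound : forall x i j, x <= l -> p i j ->
  i <= F x i j /\ F x i j + k <= m + i.
Hypothesis G_bound : forall x i j, x <= l -> p i j ->
  j <= G x i j /\ G x i j + l <= n + j.
Hypothesis F_cut : forall x i j u, x <= l -> p i j -> u <= k ->
  (i < u -> F x i j + u <= R x u + i) /\ (u <= i -> R x u + i <= F x i j + u).
Hypothesis G_incr : forall x i j i' j', x <= l -> p i j -> p i' j' -> j < j' ->
  G x i j + j' <= G x i' j' + j.
Hypothesis Oq : forall x j, x <= l -> j < l -> q i0 (O x j).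
Hypothesis O_ge : forall x j, x <= l -> j < l -> l <= O x j.
Hypothesis O_gap : forall x j j', x <= l -> j < j' -> j' < l -> O x j + l <= O x j'.
Hypothesis O_left : forall x j, x <= l -> j < l -> O x j + l <= G x rL gL.
Hypothesis O_right : forall x j, x < l -> j < l -> G x rR gR + l <= O x.+1 j.

Lemma F_incr x i j i' j' : x <= l -> p i j -> p i' j' -> i < i' ->
  F x i j + i' <= F x i' j' + i.
Proof.
move=> hx pa pb ii'; have [i'k _] := p_bound pb.
have [h _] := F_cut hx pa (ltnW i'k); have [_ h'] := F_cut hx pb (ltnW i'k).
by have := h ii'; have := h' (leqnn _); clear; lia.
Qed.

Lemma l_gt2 : 2 < l.
Proof. by have [_ h] := p_bound pR; clear -h ltL ltR; lia. Qed.

(** The entries [O] separate the images of the columns from [gL] to [gR] in successive copies; the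
    slack of [l] on each side makes room for empty columns. *)
Lemma copies_apart x y : x < y -> y <= l -> G x rR gR + l + l <= G y rL gL.
Proof.
elim: y => // y IH; rewrite ltnS leq_eqVlt => /orP[/eqP->|xy] yl.
  have l0 : 0 < l by have := l_gt2; clear; lia.
  by have := O_right yl l0; have := O_left yl l0; clear; lia.
have := IH xy (ltnW yl).
have l0 : 0 < l by have := l_gt2; clear; lia.
have := O_right yl l0; have := O_left yl l0.
by have := G_incr (ltnW yl) pL pR (ltn_trans ltL ltR); clear -ltL ltR; lia.
Qed.

(** Up to column [gam], a copy stays left of its own image of [(rR, gR)], hence left of the entries
    [O] of all later copies. Beyond that image nothing is known, which is why the gluing happens at
    column [gam]. *)
Lemma copy_before x y i j t : x < y -> y <= l -> p i j -> j <= gam -> t < l ->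
  G x i j + l <= O y t.
Proof.
move=> xy yl pij jg tl.
have hx : x <= l := leq_trans (ltnW xy) yl.
have h := G_incr hx pij pR (leq_ltn_trans jg ltR).
have h' : j < gR := leq_ltn_trans jg ltR.
have l0 : 0 < l by have := l_gt2; clear; lia.
case: y xy yl => // y; rewrite ltnS leq_eqVlt => /orP[/eqP E|xy] yl.
  by subst x; have := O_right yl tl; clear -h h'; lia.
have := copies_apart xy (ltnW yl); have := O_right yl tl.
by have := G_incr (ltnW yl) pL pR (ltn_trans ltL ltR); clear -h h' ltL ltR; lia.
Qed.

Lemma copy_after x y i j t : y <= x -> x <= l -> p i j -> gam <= j -> t < l ->
  O y t + l <= G x i j.
Proof.
move=> yx xl pij jg tl.
have h := G_incr xl pL pij (leq_trans ltL jg).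
have h' : gL < j := leq_trans ltL jg.
have h2 := O_left (leq_trans yx xl) tl.
move: yx; rewrite leq_eqVlt => /orP[/eqP E|yx].
  by subst x; clear -h h' h2; lia.
have := copies_apart yx xl.
by have := G_incr (leq_trans (ltnW yx) xl) pL pR (ltn_trans ltL ltR); clear -h h' h2 ltL ltR; lia.
Qed.

Lemma O_le x j : x <= l -> j < l -> O x j + l <= n.
Proof.
move=> xl jl; have := O_left xl jl; have [_] := G_bound xl pL.
by have [_ h] := p_bound pL; clear -h; lia.
Qed.

Lemma O_lt x y s t : x < y -> y <= l -> s < l -> t < l -> O x s + l <= O y t.
Proof.
move=> xy yl sl tl; have hx : x <= l := leq_trans (ltnW xy) yl.
have := O_left hx sl; have := copy_before xy yl pL (ltnW ltL) tl.
by clear; lia.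
Qed.

(** * Hybrids of several copies *)

Section Hybrid.

Variables (x y : nat) (sigma tau : nat -> nat).
Hypothesis yl : y <= l.
Hypothesis sigma_xy : forall i, x <= sigma i <= y.

Definition source i j := if j < gam then x else if gam < j then y else sigma i.

Hypothesis tau_q : forall j, p rho j ->
  [/\ q i0 (tau j), l <= tau j & tau j + l <= n].
Hypothesis tau_incr : forall j j', p rho j -> p rho j' -> j < j' ->
  tau j + j' <= tau j' + j.
Hypothesis tau_left : forall j i' j', p rho j -> p i' j' -> i' != rho ->
  j' < j -> G (source i' j') i' j' + l <= tau j.
Hypothesis tau_right : forall j i' j', p rho j -> p i' j' -> i' != rho ->
  j < j' -> tau j + l <= G (source i' j') i' j'.
Hypothesis rows : forall i j i' j', p i j -> p i' j' -> i < i' ->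
  same_side rho i i' -> source i j != source i' j' ->
  F (source i j) i j + i' <= F (source i' j') i' j' + i.

Lemma source_le i j : source i j <= l.
Proof.
have := sigma_xy i; rewrite /source; case: ltngtP => _; move: yl; clear; lia.
Qed.

Lemma source_homo i j i' j' : j < j' -> source i j <= source i' j'.
Proof.
move=> jj'; have := sigma_xy i; have := sigma_xy i'; rewrite /source.
by case: (ltngtP j gam) => h; case: (ltngtP j' gam) => h'; clear -jj' h h'; lia.
Qed.

(** Every copy sends [(rho, gam)] to row [i0], so points on opposite sides of row [rho] stay in
    order even when taken from different copies. On one side the order of rows is the hypothesis
    [rows]. *)
Lemma hybrid_emb : exists f g, emb k l m n p q f g.
Proof.
exists (fun i j => if i == rho then i0 else F (source i j) i j).
exists (fun i j => if i == rho then tau j else G (source i j) i j).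
have [l0 hl] : x <= l /\ forall i j, source i j <= l.
  by split; [have := sigma_xy 0; move: yl; clear; lia | exact: source_le].
move=> i j pij; have [ik jl] := p_bound pij; split.
  case: eqP => [E|/eqP ni].
    subst i; have [tq t1 t2] := tau_q pij; have := F_bound l0 ps; rewrite Fs // => hb.
    by split=> //; clear -t1 t2 jl; lia.
  split; [by apply: FGq => //; left | exact: F_bound | exact: G_bound].
move=> i' j' pij'; have [ik' jl'] := p_bound pij'; split => [ii'|jj'].
  case: eqP => [E|/eqP ni]; case: eqP => [E'|/eqP ni'].
  - by clear -ii' E E'; lia.
  - by subst i; rewrite -(Fs (hl i' j')); exact: F_incr.
  - by subst i'; rewrite -(Fs (hl i j)); exact: F_incr.
  case: (eqVneq (source i j) (source i' j')) => [->|ns]; first exact: F_incr.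
  have [ss|nss] := classic (same_side rho i i'); first exact: rows.
  have h1 : i < rho by clear -nss ni ni' ii'; move: nss; rewrite /same_side; lia.
  have h2 : rho < i' by clear -nss ni ni' ii'; move: nss; rewrite /same_side; lia.
  have := F_incr (hl i j) pij ps h1; have := F_incr (hl i' j') ps pij' h2.
  by rewrite !Fs //; clear; lia.
case: eqP => [E|/eqP ni]; case: eqP => [E'|/eqP ni'].
- by subst i i'; exact: tau_incr.
- by subst i; have := tau_right pij pij' ni' jj'; clear -jl'; lia.
- by subst i'; have := tau_left pij' pij ni jj'; clear -jl'; lia.
case: (ltngtP (source i j) (source i' j')) (source_homo i i' jj') => // [lt|E] _.
  2: by rewrite E; exact: G_incr.
(* Different copies occur only for [j <= gam <= j']: the first image is left of the image of
   [(rR, gR)] in its copy, the second right of that of [(rL, gL)] in a later one. *)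
have jg : j <= gam.
  move: lt; rewrite /source; case: (ltngtP j gam) => // h1.
  by have := ltn_trans h1 jj'; case: (ltngtP j' gam) => // _ _; rewrite ltnn.
have jg' : gam <= j'.
  rewrite leqNgt; apply/negP => h1; move: lt; rewrite /source h1.
  by rewrite (ltn_trans jj' h1) ltnn.
have := copies_apart lt (hl i' j').
have := G_incr (hl i j) pij pR (leq_ltn_trans jg ltR).
have := G_incr (hl i' j') pL pij' (leq_trans ltL jg').
by clear -ltL ltR jg jg' jl jl'; lia.
Qed.

End Hybrid.

(** Column [j] is served by copy [j] alone: its point in row [rho] goes to [O j 0], its point in row
    [rb] to the image of [(rb, gb)]. These positions alternate, so any arrangement of two rows
    fits. *)
Lemma two_rows_emb rb gb : (rb, gb) = (rL, gL) \/ (rb, gb) = (rR, gR) ->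
  (forall i j, p i j -> i = rho \/ i = rb) -> exists f g, emb k l m n p q f g.
Proof.
move=> hb two.
have [pb nb gbg] : [/\ p rb gb, rb != rho & gb != gam].
  by case: hb => [[-> ->]|[-> ->]]; split=> //; clear -ltL ltR; lia.
exists (fun i j => if i == rho then i0 else F j rb gb).
exists (fun i j => if i == rho then O j 0 else G j rb gb).
have l0 : 0 < l by have := l_gt2; clear; lia.
have Gb x : x <= l -> O x 0 + l <= G x rb gb /\ G x rb gb <= G x rR gR.
  move=> xl; have := O_left xl l0.
  have := G_incr xl pL pR (ltn_trans ltL ltR).
  by case: hb => [[-> ->]|[-> ->]]; clear -ltL ltR; lia.
have Gn x y : x < y -> y <= l -> G x rb gb + l <= O y 0.
  move=> xy yl; have [_ h] := Gb x (leq_trans (ltnW xy) yl).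
  have xl : x < l := leq_trans xy yl.
  have := O_right xl l0.
  move: xy; rewrite leq_eqVlt => /orP[/eqP <-|xy]; first by clear -h; lia.
  by have := O_lt xy yl l0 l0; clear -h; lia.
move=> i j pij; have [ik jl] := p_bound pij; have jl' := ltnW jl.
have Fb x : x <= l -> (rho < rb -> i0 + rb <= F x rb gb + rho) /\
    (rb < rho -> F x rb gb + rho <= i0 + rb).
  by move=> xl; rewrite -(Fs xl); split; exact: F_incr.
have Eb i1 j1 : p i1 j1 -> i1 <> rho -> i1 = rb by move=> /two[].
split.
  case: eqP => [E|ni].
    subst i; have := F_bound jl' ps; rewrite Fs // => hF; split=> //.
      by apply: Oq.
    by have := O_ge jl' l0; have := O_le jl' l0; clear -jl; lia.
  split.
  - by apply: FGq => //; right.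
  - by rewrite (Eb _ _ pij ni); exact: F_bound.
  - have := O_ge jl' l0; have [h _] := Gb _ jl'.
    have [_ h2] := G_bound jl' pb; have [_ h3] := p_bound pb.
    have := O_lt (jl : j < l) (leqnn _) l0 l0.
    have := Gn _ _ jl (leqnn _); have := O_le (leqnn l) l0.
    by clear -h jl; lia.
move=> i' j' pij'; have [ik' jl1'] := p_bound pij'; have jl2' := ltnW jl1'; split=> [ii'|jj'].
  have [h1 h2] := Fb j jl'; have [h3 h4] := Fb j' jl2'.
  case: eqP => [E|ni]; case: eqP => [E'|ni'].
  - by clear -E E' ii'; lia.
  - by subst i; rewrite (Eb _ _ pij' ni') in ii' *; exact: (proj1 (Fb j' jl2')).
  - by subst i'; rewrite (Eb _ _ pij ni) in ii' *; exact: (proj2 (Fb j jl')).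
  - by have := Eb _ _ pij ni; have := Eb _ _ pij' ni'; clear -ii'; lia.
have := Gn _ _ jj' jl2'; have [h1 _] := Gb _ jl'; have [h2 _] := Gb _ jl2'.
by case: eqP => _; case: eqP => _; clear -h1 h2 jj' jl1'; lia.
Qed.

Lemma O_incr x y s t s' t' : x <= y -> y <= l -> s < l -> t < l -> s' <= l -> t' <= l ->
  (x < y \/ s < t) -> O x s + t' <= O y t + s'.
Proof.
move=> xy yl sl tl sl' tl' [h|h].
  by have := O_lt h yl sl tl; clear -tl'; lia.
move: xy; rewrite leq_eqVlt => /orP[/eqP E|h'].
  by subst y; have := O_gap yl h tl; clear -tl'; lia.
by have := O_lt h' yl sl tl; clear -tl'; lia.
Qed.

(** Copies 0, 1 and 2 supply the points left of, in and right of column [gam]. By flatness and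
    [left_right_same_row], points of different copies on one side of row [rho] share their row, so
    no row order can fail. *)
Lemma flat_emb : ~ crossL p rho gam -> ~ crossR p rho gam -> flat p rho gam ->
  exists f g, emb k l m n p q f g.
Proof.
move=> nL nR fl; have l2 := l_gt2; have l1 := ltnW l2; have l0 := ltnW l1.
pose tau j := if j < gam then O 1 j else O 2 j.
have tE j : j < gam /\ tau j = O 1 j \/ gam <= j /\ tau j = O 2 j.
  by rewrite /tau; case: ltnP; [left | right].
apply: (@hybrid_emb 0 2 (fun=> 1) tau) => //.
- move=> j pj; have [_ jl] := p_bound pj.
  by case: (tE j) => -[_ ->]; split; first [exact: Oq | exact: O_ge | exact: O_le].
- move=> j j' pj pj' jj'; have [_ jl] := p_bound pj; have [_ jl'] := p_bound pj'.
  by case: (tE j) => -[h ->]; case: (tE j') => -[h' ->]; apply: O_incr => //;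
    try (exact: ltnW); try (by right); try (by left); clear -h h' jj'; lia.
- move=> j i' j' pj pij' ni jj'; have [_ jl] := p_bound pj.
  rewrite /source; case: (ltngtP j' gam) => h.
  + by case: (tE j) => -[_ ->]; apply: copy_before => //; exact: ltnW.
  + by case: nR; exists j, i', j'; rewrite h.
  + case: (tE j) => -[h' ->]; first by clear -h h' jj'; lia.
    by apply: copy_before => //; rewrite h.
- move=> j i' j' pj pij' ni jj'; have [_ jl] := p_bound pj.
  rewrite /source; case: (ltngtP j' gam) => h.
  + by case: nL; exists j, i', j'; rewrite jj' h.
  + by case: (tE j) => -[_ ->]; apply: copy_after => //; exact: ltnW.
  + case: (tE j) => -[h' ->]; last by clear -h h' jj'; lia.
    by apply: copy_after => //; rewrite h.
- move=> i j i' j' pij pij' ii' ss; rewrite /source => ns; exfalso.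
  suff E : i = i' by move: ii'; rewrite E ltnn.
  move: ns; case: (ltngtP j gam) => [h|h|h]; case: (ltngtP j' gam) => [h'|h'|h'] //= _;
    try (subst j; exact: fl pij pij' ss);
    try (subst j'; apply: esym; exact: fl pij' pij (same_side_sym ss)).
    exact: (left_right_same_row mono ps pij pij').
  by apply: esym; apply: (left_right_same_row mono ps pij' pij) => //; exact: same_side_sym.
Qed.

(** Copy 0 supplies the points left of column [gam], copy 1 the others, and row [rho] fits on the
    entries [O 1] in between. By [freeL], points of column [gam] never have to be compared with
    points from copy 0 on their side. *)
Lemma freeL_emb : ~ crossL p rho gam -> freeL p rho gam ->
  (forall j, p rho j -> j <= gam) -> exists f g, emb k l m n p q f g.
Proof.
move=> nL fl le; have l2 := l_gt2; have l1 := ltnW l2; have l0 := ltnW l1.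
apply: (@hybrid_emb 0 1 (fun=> 1) (O 1)) => //.
- move=> j pj; have [_ jl] := p_bound pj.
  by split; [exact: Oq | exact: O_ge | exact: O_le].
- move=> j j' pj pj' jj'; have [_ jl] := p_bound pj; have [_ jl'] := p_bound pj'.
  by apply: O_incr => //; try (exact: ltnW); right.
- move=> j i' j' pj pij' ni jj'; have [_ jl] := p_bound pj.
  have h : j' < gam := leq_trans jj' (le _ pj).
  by rewrite /source h; apply: copy_before => //; exact: ltnW.
- move=> j i' j' pj pij' ni jj'; have [_ jl] := p_bound pj.
  rewrite /source; case: (ltngtP j' gam) => h.
  + by case: nL; exists j, i', j'; rewrite jj' h.
  + by apply: copy_after => //; exact: ltnW.
  + by apply: copy_after => //; rewrite h.
- move=> i j i' j' pij pij' ii' ss; rewrite /source => ns; exfalso.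
  move: ns; case: (ltngtP j gam) => [h|h|h]; case: (ltngtP j' gam) => [h'|h'|h'] //= _.
  + have E := left_right_same_row mono ps pij pij' h h' ss.
    by move: ii'; rewrite E ltnn.
  + by subst j'; have := fl _ _ _ pij' pij (same_side_sym ss); rewrite leqNgt h.
  + have E := left_right_same_row mono ps pij' pij h' h (same_side_sym ss).
    by move: ii'; rewrite E ltnn.
  + by subst j; have := fl _ _ _ pij pij' ss; rewrite leqNgt h'.
Qed.

(** Mirror image of [freeL_emb]: column [gam] now comes from copy 0. *)
Lemma freeR_emb : ~ crossR p rho gam -> freeR p rho gam ->
  (forall j, p rho j -> gam <= j) -> exists f g, emb k l m n p q f g.
Proof.
move=> nR fl ge; have l2 := l_gt2; have l1 := ltnW l2; have l0 := ltnW l1.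
apply: (@hybrid_emb 0 1 (fun=> 0) (O 1)) => //.
- move=> j pj; have [_ jl] := p_bound pj.
  by split; [exact: Oq | exact: O_ge | exact: O_le].
- move=> j j' pj pj' jj'; have [_ jl] := p_bound pj; have [_ jl'] := p_bound pj'.
  by apply: O_incr => //; try (exact: ltnW); right.
- move=> j i' j' pj pij' ni jj'; have [_ jl] := p_bound pj.
  rewrite /source; case: (ltngtP j' gam) => h.
  + by apply: copy_before => //; exact: ltnW.
  + by case: nR; exists j, i', j'; rewrite h.
  + by apply: copy_before => //; rewrite h.
- move=> j i' j' pj pij' ni jj'; have [_ jl] := p_bound pj.
  have h : gam < j' := leq_ltn_trans (ge _ pj) jj'.
  rewrite /source ltnNge (ltnW h) h /=.
  by apply: copy_after => //; exact: ltnW.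
- move=> i j i' j' pij pij' ii' ss; rewrite /source => ns; exfalso.
  move: ns; case: (ltngtP j gam) => [h|h|h]; case: (ltngtP j' gam) => [h'|h'|h'] //= _.
  + have E := left_right_same_row mono ps pij pij' h h' ss.
    by move: ii'; rewrite E ltnn.
  + have E := left_right_same_row mono ps pij' pij h' h (same_side_sym ss).
    by move: ii'; rewrite E ltnn.
  + by subst j'; have := fl _ _ _ pij' pij (same_side_sym ss); rewrite leqNgt h.
  + by subst j; have := fl _ _ _ pij pij' ss; rewrite leqNgt h'.
Qed.

(* On one side of row [rho], the points of column [gam] above (below) the common
   row [u] of the other points are taken from the copy whose cut at [u] is
   highest (lowest). *)
Lemma side_sources (side : nat -> Prop) :
  (forall i j i' j', p i j -> p i' j' -> j < gam -> gam < j' ->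
    side i -> side i' -> i = i') ->
  exists sigma : nat -> nat, (forall i, sigma i <= 1) /\
    forall i j i' j', p i j -> p i' j' -> i < i' -> side i -> side i' ->
      source 0 1 sigma i j != source 0 1 sigma i' j' ->
      F (source 0 1 sigma i j) i j + i' <= F (source 0 1 sigma i' j') i' j' + i.
Proof.
move=> same; have l2 := l_gt2; have l1 := ltnW l2.
case: (classic (exists i j, [/\ p i j, side i & j < gam])) => [[u [ju [pu su ujg]]]|nA].
  case: (classic (exists i j, [/\ p i j, side i & gam < j])) => [[v [jv [pv sv vjg]]]|nC].
    have E := same _ _ _ _ pu pv ujg vjg su sv; subst v.
    have rowu i j : p i j -> side i -> j != gam -> i = u.
      move=> pij si; case: (ltngtP j gam) => // h _.
        exact: (same _ _ _ _ pij pv).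
      exact/esym/(same _ _ _ _ pu pij).
    pose sigma i := if i < u then (if R 0 u <= R 1 u then 0 else 1)
                    else (if R 0 u.+1 <= R 1 u.+1 then 1 else 0).
    have s1 i : sigma i <= 1 by rewrite /sigma; case: ifP => _; case: ifP.
    exists sigma; split=> // i j i' j' pij pij' ii' si si' ns.
    have sl t s : source 0 1 sigma t s <= 1.
      by rewrite /source; case: ifP => // _; case: ifP.
    have [uk _] := p_bound pu.
    have cut t t' i1 j1 w (p1 : p i1 j1) (wk : w <= k) :=
      F_cut (leq_trans (sl t t') (ltnW l1)) p1 wk.
    (* For [i < u <= i'] the cut at [u] separates the images, since the copy chosen for row [i] has
       the smaller value [R _ u]. Below, for [u < i'], the cut at [u.+1] is used with the larger
       value. *)
    case: (ltnP i u) => iu.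
      have jE : j = gam by apply/eqP; apply: contraT => /(rowu _ _ pij si) E; move: iu; rewrite E ltnn.
      have [h _] := cut i j _ _ _ pij (ltnW uk); move: {h}(h iu).
      have ui' : u <= i'.
        rewrite leqNgt; apply/negP => i'u.
        have jE' : j' = gam by apply/eqP; apply: contraT => /(rowu _ _ pij' si') E; move: i'u; rewrite E ltnn.
        by move: ns; rewrite /source jE jE' ltnn /sigma iu i'u eqxx.
      have [_ h] := cut i' j' _ _ _ pij' (ltnW uk); move: {h}(h ui').
      have : R (source 0 1 sigma i j) u <= R (source 0 1 sigma i' j') u.
        have -> : source 0 1 sigma i j = sigma i by rewrite /source jE ltnn.
        move: (source _ _ _ i' j') (sl i' j') => b; rewrite /sigma iu.
        by case: b => [|[|b]] // _; case: (leqP (R 0 u) (R 1 u)) => // /ltnW.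
      by clear; lia.
    have ui' : u < i' := leq_ltn_trans iu ii'.
    have jE' : j' = gam by apply/eqP; apply: contraT => /(rowu _ _ pij' si') E; move: ui'; rewrite E ltnn.
    have [_ h] := cut i' j' _ _ _ pij' uk; move: {h}(h ui').
    have iE : i < u.+1.
      rewrite ltnS leqNgt; apply/negP => ui.
      have jE : j = gam by apply/eqP; apply: contraT => /(rowu _ _ pij si) E; move: ui; rewrite E ltnn.
      by move: ns; rewrite /source jE jE' ltnn /sigma ltnNge iu ltnNge (ltnW ui') eqxx.
    have [h _] := cut i j _ _ _ pij uk; move: {h}(h iE).
    have : R (source 0 1 sigma i j) u.+1 <= R (source 0 1 sigma i' j') u.+1.
      have -> : source 0 1 sigma i' j' = sigma i' by rewrite /source jE' ltnn.
      move: (source _ _ _ i j) (sl i j) => b; rewrite /sigma [i' < u]ltnNge (ltnW ui') /=.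
      by case: b => [|[|b]] // _; case: (leqP (R 0 u.+1) (R 1 u.+1)) => // /ltnW.
    by clear; lia.
  (* Without points on one side of column [gam], all points come from a single copy: copy 0 here,
     copy 1 in the last case. *)
  exists (fun=> 0); split=> // i j i' j' pij pij' ii' si si'; rewrite /source.
  by case: (ltngtP j gam) => h; case: (ltngtP j' gam) => h' //=;
    case: nC; first [by exists i, j | by exists i', j'].
exists (fun=> 1); split=> // i j i' j' pij pij' ii' si si'; rewrite /source.
by case: (ltngtP j gam) => h; case: (ltngtP j' gam) => h' //=;
  case: nA; first [by exists i, j | by exists i', j'].
Qed.

(** By alignment, the part of row [rho] left of [gam] may precede all other points and the part
    right of [gam] may follow them, except for points in the same direction from [gam], with which
    it shares its column. Hence [O 0], [O 1] and [O 2]; rows are handled by [side_sources] above and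
    below [rho] separately. *)
Lemma aligned_emb : alignedL p rho gam -> alignedR p rho gam ->
  exists f g, emb k l m n p q f g.
Proof.
move=> aL aR; have l2 := l_gt2; have l1 := ltnW l2; have l0 := ltnW l1.
have same i j i' j' : p i j -> p i' j' -> j < gam -> gam < j' ->
  same_side rho i i' -> i = i' by exact: (left_right_same_row mono ps).
have [su [su1 Hu]] : exists sigma : nat -> nat, (forall i, sigma i <= 1) /\ _ :=
  @side_sources (fun i => i < rho)
    (fun _ _ _ _ a b c d e f => same _ _ _ _ a b c d (or_introl (conj e f))).
have [sd [sd1 Hd]] : exists sigma : nat -> nat, (forall i, sigma i <= 1) /\ _ :=
  @side_sources (fun i => rho < i)
    (fun _ _ _ _ a b c d e f => same _ _ _ _ a b c d (or_intror (conj e f))).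
pose tau j := if j < gam then O 0 j else if gam < j then O 2 j else O 1 j.
have tE j : [\/ j < gam /\ tau j = O 0 j, gam < j /\ tau j = O 2 j | j = gam /\ tau j = O 1 j].
  by rewrite /tau; case: ltngtP; [constructor 1 | constructor 2 | constructor 3].
pose sigma i := if i < rho then su i else sd i.
have sE i : sigma i <= 1 by rewrite /sigma; case: ifP.
apply: (@hybrid_emb 0 1 sigma tau) => //.
- move=> j pj; have [_ jl] := p_bound pj.
  by case: (tE j) => -[_ ->]; split; first [exact: Oq | exact: O_ge | exact: O_le].
- move=> j j' pj pj' jj'; have [_ jl] := p_bound pj; have [_ jl'] := p_bound pj'.
  by case: (tE j) => -[h ->]; case: (tE j') => -[h' ->]; apply: O_incr => //;
    try (exact: ltnW); try (by right); try (by left); clear -h h' jj'; lia.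
- move=> j i' j' pj pij' ni jj'; have [_ jl] := p_bound pj.
  rewrite /source; case: (ltngtP j' gam) => h.
  + case: (tE j) => -[h' ->]; try (by apply: copy_before => //; exact: ltnW).
    by move: jj'; rewrite (aL _ _ _ pj pij' ni h' h) ltnn.
  + have h' := ltn_trans h jj'.
    by move: jj'; rewrite (aR _ _ _ pj pij' ni h' h) ltnn.
  + have h' : gam < j by rewrite -h.
    case: (tE j) => -[h'' ->]; try (by clear -h' h''; lia).
    by apply: copy_before => //; [exact: sE | rewrite h].
- move=> j i' j' pj pij' ni jj'; have [_ jl] := p_bound pj.
  rewrite /source; case: (ltngtP j' gam) => h.
  + have h' := ltn_trans jj' h.
    by move: jj'; rewrite (aL _ _ _ pj pij' ni h' h) ltnn.
  + case: (tE j) => -[h' ->]; try (by apply: copy_after => //; exact: ltnW).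
    by move: jj'; rewrite (aR _ _ _ pj pij' ni h' h) ltnn.
  + have h' : j < gam by rewrite -h.
    case: (tE j) => -[h'' ->]; try (by clear -h' h''; lia).
    by apply: copy_after => //; [exact: leq_trans (sE _) l0 | rewrite h].
- move=> i j i' j' pij pij' ii' ss.
  have E s t t' : (forall i0, same_side rho i i0 -> sigma i0 = s i0) -> 
      (t = i \/ t = i') -> source 0 1 sigma t t' = source 0 1 s t t'.
    move=> Es ht; rewrite /source; case: ltngtP => // _; apply: Es.
    by case: ht => ->//; apply: same_side_trans ss (same_side_sym ss).
  case: ss (ss) => -[a b] ss.
    have Es i1 : same_side rho i i1 -> sigma i1 = su i1.
      by rewrite /sigma; case=> -[c d]; [rewrite d | move: a; rewrite ltnNge (ltnW c)].
    by rewrite (E su) ?(E su i') //; auto; exact: Hu.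
  have Es i1 : same_side rho i i1 -> sigma i1 = sd i1.
    by rewrite /sigma; case=> -[c d]; [move: a; rewrite ltnNge (ltnW c) | rewrite ltnNge (ltnW d)].
  by rewrite (E sd) ?(E sd i') //; auto; exact: Hd.
Qed.

Lemma family_emb : exists f g, emb k l m n p q f g.
Proof.
have [cL|nL] := classic (crossL p rho gam).
  apply: (@two_rows_emb rR gR); first by right.
  exact: (crossL_two_rows mono ps pL pR rhoL rhoR ltL ltR cL).
have [cR|nR] := classic (crossR p rho gam).
  apply: (@two_rows_emb rL gL); first by left.
  exact: (crossR_two_rows mono ps pL pR rhoL rhoR ltL ltR cR).
case: (uncrossed_shape mono ps pL pR rhoL rhoR ltL ltR nL nR) => [[aL aR]|fl|[fL le]|[fR ge]].
- exact: aligned_emb.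
- exact: flat_emb.
- exact: freeL_emb.
- exact: freeR_emb.
Qed.

End Gluing.

(** * Copies around a 0-entry *)

(** Entries outside the matrix count as 0, so maps of points can work with plain natural numbers. *)
Definition ent m n (M : 'M[bool]_(m, n)) (a b : nat) : bool :=
  if insub a is Some i then if insub b is Some j then M i j else false else false.

Lemma entE m n (M : 'M[bool]_(m, n)) (i : 'I_m) (j : 'I_n) : ent M i j = M i j.
Proof. by rewrite /ent !valK. Qed.

Lemma entP m n (M : 'M[bool]_(m, n)) a b :
  ent M a b -> exists (i : 'I_m) (j : 'I_n), [/\ a = i, b = j & M i j].
Proof.
rewrite /ent; case: insubP => // i _ <-; case: insubP => // j _ <- Mij.
by exists i, j.
Qed.

Lemma ent_bound m n (M : 'M[bool]_(m, n)) a b : ent M a b -> a < m /\ b < n.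
Proof. by move=> /entP[i [j [-> -> _]]]; rewrite !ltn_ord. Qed.

(** * Cuts and images of points *)

Definition grid (k m : nat) (r : nat -> nat) : Prop :=
  [/\ r 0 = 0, r k = m & forall i, i < k -> r i < r i.+1].

(** Images are kept together with their cuts, because rows of different copies are compared through
    the cuts. *)
Definition copy k l m n (p q : nat -> nat -> bool) (f g : nat -> nat -> nat)
    (r c : nat -> nat) : Prop :=
  [/\ grid k m r, grid l n c & forall i j, p i j ->
    [/\ q (f i j) (g i j), r i <= f i j < r i.+1 & c j <= g i j < c j.+1]].

Lemma grid_gap k m r i i' : grid k m r -> i <= i' -> i' <= k -> r i + i' <= r i' + i.
Proof.
move=> [_ _ rS]; elim: i' => [|i' IH]; first by rewrite leqn0 => /eqP ->.
rewrite leq_eqVlt => /orP[/eqP -> //|ii'] i'k.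
by have := IH ii' (ltnW i'k); have := rS i' i'k; clear; lia.
Qed.

Lemma grid_cut k m r i v u : grid k m r -> i < k -> r i <= v < r i.+1 -> u <= k ->
  (i < u -> v + u <= r u + i) /\ (u <= i -> r u + i <= v + u).
Proof.
move=> gr ik /andP[v1 v2] uk; split=> iu.
  by have := grid_gap gr iu uk; clear -v2; lia.
by have := grid_gap gr iu (ltnW ik); clear -v1; lia.
Qed.

Lemma grid_bound k m r i v : grid k m r -> i < k -> r i <= v < r i.+1 ->
  i <= v /\ v + k <= m + i.
Proof.
move=> gr ik hv; case: (gr) => r0 rk _.
have [_ h1] := grid_cut gr ik hv (leq0n _).
have [h2 _] := grid_cut gr ik hv (leqnn k).
by have := h1 (leq0n _); have := h2 ik; rewrite r0 rk; clear; lia.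
Qed.

Lemma grid_incr k m r i v i' v' : grid k m r -> i < k -> r i <= v < r i.+1 ->
  i' < k -> r i' <= v' < r i'.+1 -> i < i' -> v + i' <= v' + i.
Proof.
move=> gr ik hv ik' hv' ii'.
have [h1 _] := grid_cut gr ik hv (ltnW ik').
by have := h1 ii'; case/andP: hv' => + _; clear; lia.
Qed.

(** Cuts are placed as early as possible: a point with label [L t < u] pushes cut [u] to at least
    [V t + u - L t], and [b u] is the maximum of these bounds and [u]. The element [t0] yields
    [0 < k <= m]. *)
Lemma grid_exists (k m : nat) (T : finType) (A : pred T) (L V : T -> nat) (t0 : T) :
  A t0 -> (forall t, A t -> [/\ L t < k, L t <= V t & V t + k <= m + L t]) ->
  (forall t t', A t -> A t' -> L t < L t' -> V t + L t' <= V t' + L t) ->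
  exists r, grid k m r /\ forall t, A t -> r (L t) <= V t < r (L t).+1.
Proof.
move=> A0 bd inc.
pose b u := maxn u (\max_(t | A t && (L t < u)) (V t + u - L t)).
pose r u := if u < k then b u else m.
have bP u w : reflect (u <= w /\ forall t, A t -> L t < u -> V t + u - L t <= w) (b u <= w).
  rewrite /b geq_max; apply: (iffP andP) => [[uw /bigmax_leqP h]|[uw h]].
    by split=> // t At Lt; apply: h; rewrite At.
  by split=> //; apply/bigmax_leqP => t /andP[At Lt]; apply: h.
have bS u : b u < b u.+1.
  have [h1 h2] := bP u.+1 _ (leqnn (b u.+1)).
  have: 0 < b u.+1 by apply: leq_trans h1.
  case E: (b u.+1) => [//|w] _; rewrite ltnS; apply/bP; split; first by rewrite -ltnS -E.
  move=> t At Lt; have := h2 t At (ltnW Lt).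
  by rewrite E; have [_ h3 _] := bd _ At; clear -h3; lia.
have bm u : u < k -> b u < m.
  move=> uk; have [k0 _ km] := bd _ A0; have [_ h0 _] := bd _ A0.
  suff : b u <= m.-1 by clear -k0 h0 km; lia.
  apply/bP; split; first by clear -uk km h0 k0; lia.
  by move=> t At Lt; have [_ h3 h4] := bd _ At; clear -h3 h4 uk; lia.
have k0 : 0 < k by have [h _ _] := bd _ A0; apply: leq_ltn_trans h.
exists r; split.
  split; last 1 first.
  - move=> i ik; rewrite /r ik; case: (ltnP i.+1 k) => _; [exact: bS | exact: bm].
  - rewrite /r k0; apply/eqP; rewrite -leqn0; apply/bP; split=> //.
  - by rewrite /r ltnn.
move=> t At; have [Lk LV Vm] := bd _ At; rewrite /r Lk; apply/andP; split.
  apply/bP; split=> // t' At' Lt'.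
  by have := inc _ _ At' At Lt'; clear; lia.
case: (ltnP (L t).+1 k) => kL; last by clear -Vm kL Lk; lia.
have [_ h] := bP (L t).+1 _ (leqnn (b (L t).+1)).
by have := h t At (leqnn _); clear -LV; lia.
Qed.

Lemma emb_minor k l m n (P : 'M[bool]_(k, l)) (M : 'M[bool]_(m, n)) a b f g :
  ent P a b -> emb k l m n (ent P) (ent M) f g -> interval_minor P M.
Proof.
move=> /entP[i0 [j0 [_ _ P0]]] E.
pose A (t : 'I_k * 'I_l) := P t.1 t.2.
have AE t : A t -> ent P t.1 t.2 by rewrite entE.
have [r [gr rP]] : exists r, grid k m r /\ forall t, A t -> r t.1 <= f t.1 t.2 < r t.1.+1.
  apply: (@grid_exists k m _ A (fun t => val t.1) (fun t => f t.1 t.2) (i0, j0)) => //.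
    by move=> t /AE /E[[_ [h1 h2] _] _]; split; rewrite /= ?ltn_ord.
  by move=> t t' /AE /E[_ h] /AE /h[h1 _] /h1.
have [c [gc cP]] : exists c, grid l n c /\ forall t, A t -> c t.2 <= g t.1 t.2 < c t.2.+1.
  apply: (@grid_exists l n _ A (fun t => val t.2) (fun t => g t.1 t.2) (i0, j0)) => //.
    by move=> t /AE /E[[_ _ [h1 h2]] _]; split; rewrite /= ?ltn_ord.
  by move=> t t' /AE /E[_ h] /AE /h[_ h1] /h1.
exists r, c; split=> //; split=> // i j Pij.
have := E i j; rewrite entE => /(_ Pij)[[/entP[x [y [xE yE Mxy]]] _ _] _].
exists x, y; split=> //.
  by have := rP (i, j) Pij; rewrite /= xE.
by have := cP (i, j) Pij; rewrite /= yE.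
Qed.

Lemma minor_copy k l m n (P : 'M[bool]_(k, l)) (M : 'M[bool]_(m, n)) :
  interval_minor P M ->
  exists f g r c, copy k l m n (ent P) (ent M) f g r c.
Proof.
move=> [r [c [gr [gc H]]]].
pose hit i j := [pick t : 'I_m * 'I_n | [&& r i <= t.1 < r i.+1, c j <= t.2 < c j.+1 & M t.1 t.2]].
(* The default 0 never occurs at a point of [P], whose block contains a 1-entry. *)
exists (fun i j => if hit i j is Some t then val t.1 else 0).
exists (fun i j => if hit i j is Some t then val t.2 else 0).
exists r, c; split=> // i j /entP[i' [j' [-> -> Pij]]].
rewrite /hit; case: pickP => [[x y] /and3P[h1 h2 h3]|no]; first by rewrite entE.
have [x [y [h1 h2 h3]]] := H _ _ Pij.
by have := no (x, y); rewrite /= h1 h2 h3.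
Qed.

(** * Points of a copy close to the flipped entry *)

Section Blockers.

Variables (k l m n : nat) (p q : nat -> nat -> bool) (i0 z : nat).
Hypothesis p_bound : forall i j, p i j -> i < k /\ j < l.
Hypothesis no_emb : ~ exists f g, emb k l m n p q f g.

Lemma copy_emb f g r c : copy k l m n p q f g r c -> emb k l m n p q f g.
Proof.
move=> [gr gc H] i j pij; have [ik jl] := p_bound pij; have [qij hr hc] := H _ _ pij.
split; first by split=> //; [exact: grid_bound gr ik hr | exact: grid_bound gc jl hc].
move=> i' j' pij'; have [ik' jl'] := p_bound pij'; have [_ hr' hc'] := H _ _ pij'.
by split; [exact: grid_incr gr ik hr ik' hr' | exact: grid_incr gc jl hc jl' hc'].
Qed.

Variables (f g : nat -> nat -> nat) (r c : nat -> nat).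
Hypothesis fg_copy :
  copy k l m n p (fun a b => q a b || (a == i0) && (b == z)) f g r c.

(** A copy missing the new entry would lie in [q]; and only one point uses the entry, since distinct
    points lie in disjoint blocks. *)
Lemma copy_center : exists rho gam,
  [/\ p rho gam, f rho gam = i0, g rho gam = z &
    forall i j, p i j -> i != rho \/ j != gam -> q (f i j) (g i j)].
Proof.
have [gr gc H] := fg_copy.
have [[rho [gam [ps /andP[/eqP fs /eqP gs]]]]|no] :=
  classic (exists i j, p i j /\ (f i j == i0) && (g i j == z)); last first.
  exfalso; apply: no_emb; exists f, g; apply: (@copy_emb _ _ r c); split=> // i j pij.
  have [h1 h2 h3] := H _ _ pij; split=> //.
  by case/orP: h1 => // h; case: no; exists i, j.
exists rho, gam; split=> // i j pij ne.
have [ik jl] := p_bound pij; have [sk sl] := p_bound ps.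
have [/orP[//|/andP[/eqP fi /eqP gj]] hr hc] := H _ _ pij.
have [_ sr sc] := H _ _ ps.
exfalso; case: (ltngtP i rho) => [lt|gt|E]; last case: (ltngtP j gam) => [lt|gt|E'].
- by have := grid_incr gr ik hr sk sr lt; clear -lt fi fs; lia.
- by have := grid_incr gr sk sr ik hr gt; clear -gt fi fs; lia.
- by have := grid_incr gc jl hc sl sc lt; clear -lt gj gs; lia.
- by have := grid_incr gc sl sc jl hc gt; clear -gt gj gs; lia.
- by case: ne; rewrite ?E ?E' eqxx.
Qed.

Variables (rho gam : nat).
Hypotheses (ps : p rho gam) (fs : f rho gam = i0) (gs : g rho gam = z).
Hypothesis fg_q : forall i j, p i j -> i != rho \/ j != gam -> q (f i j) (g i j).

(* Otherwise the points of row [rho] whose images lie in columns [z, lim) could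
   be moved onto the 1-entries [o j] of row [i0]. *)
Lemma blocker_right (o : nat -> nat) lim :
  (forall j, j < l -> [/\ q i0 (o j), z + l <= o j, o j + l <= lim & o j + l <= n]) ->
  (forall j j', j < j' -> j' < l -> o j + l <= o j') ->
  exists i j, [/\ p i j, i != rho, gam < j & g i j < lim].
Proof.
move=> oP o_gap; apply: NNPP => no; apply: no_emb.
have [gr gc H] := fg_copy; have [sk sl] := p_bound ps.
have far i j : p i j -> i != rho -> gam < j -> lim <= g i j.
  by move=> pij ni gj; rewrite leqNgt; apply/negP => h; apply: no; exists i, j.
have [_ sr sc] := H _ _ ps.
have o0 : 0 < l by apply: leq_ltn_trans sl.
have [q0 zo olim on] := oP 0 o0.
(* If [o 0] still lies in the column block of [gam], moving the single point [(rho, gam)]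
   suffices. *)
case: (ltnP (o 0) (c gam.+1)) => hc0.
  pose g' i j := if (i == rho) && (j == gam) then o 0 else g i j.
  exists f, g'; apply: (@copy_emb _ _ r c); split=> // i j pij.
  have [_ hr hc] := H _ _ pij; rewrite /g'; case: ifP => [/andP[/eqP-> /eqP->]|ne].
    rewrite sr fs; split=> //; rewrite hc0 andbT; case/andP: sc => h _.
    by move: h; rewrite gs; clear -zo; lia.
  split=> //; apply: fg_q => //; move: ne.
  by case: (i == rho); case: (j == gam) => // _; [right | left | left].
(* Otherwise all images in column [gam] except the moved one precede [o 0], and every unmoved point
   right of [gam] has its image at [lim] or later. *)
pose moved i j := [&& i == rho, gam <= j & (j == gam) || (g i j < lim)].
exists (fun i j => if moved i j then i0 else f i j).
exists (fun i j => if moved i j then o j else g i j).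
have fr i j : p i j -> r i <= (if moved i j then i0 else f i j) < r i.+1.
  move=> pij; have [_ hr _] := H _ _ pij; case: ifP => // /and3P[/eqP-> _ _].
  by rewrite -fs.
have unmoved i j : p i j -> gam < j -> ~~ moved i j -> lim <= g i j.
  move=> pij gj; rewrite /moved (ltnW gj) (gtn_eqF gj) /= negb_and => /orP[ni|].
    exact: far.
  by rewrite -leqNgt.
move=> i j pij; have [ik jl] := p_bound pij; have [_ hr hc] := H _ _ pij; split.
  split; [|exact: grid_bound gr ik (fr _ _ pij)|].
    case: ifP => [_|nm]; first by have [] := oP j jl.
    apply: fg_q => //; case: (eqVneq i rho) => [E|]; last by left.
    by right; apply/eqP => E'; move: nm; rewrite /moved E E' leqnn !eqxx.
  case: ifP => _; last exact: grid_bound gc jl hc.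
  by have [_ h1 _ h2] := oP j jl; clear -h1 h2 jl; lia.
move=> i' j' pij'; have [ik' jl'] := p_bound pij'; have [_ hr' hc'] := H _ _ pij'.
split=> [|jj']; first exact: grid_incr gr ik (fr _ _ pij) ik' (fr _ _ pij').
have orig := grid_incr gc jl hc jl' hc' jj'.
case: (boolP (moved i j)) => mv; case: (boolP (moved i' j')) => mv' //.
- by have := o_gap _ _ jj' jl'; clear -jl'; lia.
- have [_ gj _] := and3P mv; have := unmoved _ _ pij' (leq_ltn_trans gj jj') mv'.
  by have [_ _ h _] := oP j jl; clear -h jl'; lia.
have /and3P[/eqP E' gj' /orP mv2] := mv'.
have [_ h2 _ _] := oP j' jl'.
case: (ltngtP j gam) => jg.
- by have := grid_incr gc jl hc sl sc jg; rewrite gs; clear -h2 jl' jg; lia.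
- have := unmoved _ _ pij jg mv; case: mv2 => [/eqP E|].
    by clear -E jg jj'; lia.
  by clear -orig jj'; lia.
- subst j; have := o_gap 0 j' (leq_ltn_trans (leq0n _) jj') jl'.
  by case/andP: hc => _ h; clear -h hc0 jl'; lia.
Qed.

(** Mirror image of [blocker_right]: the entries [o j] lie left of [z], so the last one, [o l.-1],
    is the closest to the flipped entry. *)
Lemma blocker_left (o : nat -> nat) lim :
  (forall j, j < l -> [/\ q i0 (o j), o j + l <= z, lim + l <= o j & l <= o j]) ->
  (forall j j', j < j' -> j' < l -> o j + l <= o j') ->
  exists i j, [/\ p i j, i != rho, j < gam & lim < g i j].
Proof.
move=> oP o_gap; apply: NNPP => no; apply: no_emb.
have [gr gc H] := fg_copy; have [sk sl] := p_bound ps.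
have far i j : p i j -> i != rho -> j < gam -> g i j <= lim.
  by move=> pij ni gj; rewrite leqNgt; apply/negP => h; apply: no; exists i, j.
have [_ sr sc] := H _ _ ps.
have o0 : l.-1 < l by rewrite ltn_predL; apply: leq_ltn_trans sl.
have zn : z + l <= n + gam by have := grid_bound gc sl sc; rewrite gs; case.
have [q0 zo olim on] := oP _ o0.
case: (leqP (c gam) (o l.-1)) => hc0.
  pose g' i j := if (i == rho) && (j == gam) then o l.-1 else g i j.
  exists f, g'; apply: (@copy_emb _ _ r c); split=> // i j pij.
  have [_ hr hc] := H _ _ pij; rewrite /g'; case: ifP => [/andP[/eqP-> /eqP->]|ne].
    rewrite sr fs; split=> //; rewrite hc0; case/andP: sc => _.
    by rewrite gs; clear -zo o0; lia.
  split=> //; apply: fg_q => //; move: ne.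
  by case: (i == rho); case: (j == gam) => // _; [right | left | left].
pose moved i j := [&& i == rho, j <= gam & (j == gam) || (lim < g i j)].
exists (fun i j => if moved i j then i0 else f i j).
exists (fun i j => if moved i j then o j else g i j).
have fr i j : p i j -> r i <= (if moved i j then i0 else f i j) < r i.+1.
  move=> pij; have [_ hr _] := H _ _ pij; case: ifP => // /and3P[/eqP-> _ _].
  by rewrite -fs.
have unmoved i j : p i j -> j < gam -> ~~ moved i j -> g i j <= lim.
  move=> pij gj; rewrite /moved (ltnW gj) (ltn_eqF gj) /= negb_and => /orP[ni|].
    exact: far.
  by rewrite -leqNgt.
move=> i j pij; have [ik jl] := p_bound pij; have [_ hr hc] := H _ _ pij; split.
  split; [|exact: grid_bound gr ik (fr _ _ pij)|].
    case: ifP => [_|nm]; first by have [] := oP j jl.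
    apply: fg_q => //; case: (eqVneq i rho) => [E|]; last by left.
    by right; apply/eqP => E'; move: nm; rewrite /moved E E' leqnn !eqxx.
  case: ifP => _; last exact: grid_bound gc jl hc.
  by have [_ h1 _ h2] := oP j jl; clear -h1 h2 jl zn sl; lia.
move=> i' j' pij'; have [ik' jl'] := p_bound pij'; have [_ hr' hc'] := H _ _ pij'.
split=> [|jj']; first exact: grid_incr gr ik (fr _ _ pij) ik' (fr _ _ pij').
have orig := grid_incr gc jl hc jl' hc' jj'.
case: (boolP (moved i j)) => mv; case: (boolP (moved i' j')) => mv' //.
- by have := o_gap _ _ jj' jl'; clear -jl'; lia.
- have /and3P[/eqP E gj /orP mv2] := mv.
  have [_ h2 _ _] := oP j jl.
  case: (ltngtP j' gam) => jg.
  + have := unmoved _ _ pij' jg mv'; case: mv2 => [/eqP E1|].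
      by clear -E1 jg jj'; lia.
    by clear -orig jj'; lia.
  + by have := grid_incr gc sl sc jl' hc' jg; rewrite gs; clear -h2 jl' jg; lia.
  + subst j'; have jl2 : j < l.-1 by clear -jj' jl'; lia.
    have := o_gap _ _ jl2 o0.
    by case/andP: hc' => h _; clear -h hc0 jl'; lia.
have [_ gj _] := and3P mv'; have := unmoved _ _ pij (leq_trans jj' gj) mv.
by have [_ _ h _] := oP j' jl'; clear -h jl'; lia.
Qed.

End Blockers.

Lemma enum_ord_sorted n (A : {pred 'I_n}) : sorted ltn [seq val i | i <- enum A].
Proof.
have -> : enum A = filter (mem A) (enum 'I_n) by rewrite enumT.
apply: (subseq_sorted ltn_trans (map_subseq val (filter_subseq _ _))).
by rewrite val_enum_ord; exact: iota_ltn_sorted.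
Qed.

Lemma pigeonhole_increasing (T : finType) N b (ty : 'I_N -> T) : #|T| * b < N ->
  exists (t : T) (y : nat -> 'I_N), (forall x, x <= b -> ty (y x) = t) /\
    forall x, x < b -> y x < y x.+1.
Proof.
move=> big.
have [t ht] : exists t, b < #|[pred i | ty i == t]|.
  apply/existsP; apply: contraLR big; rewrite negb_exists => /forallP no.
  rewrite -leqNgt -{1}(card_ord N) -sum1_card (partition_big ty predT) //=.
  rewrite -sum_nat_const; apply: leq_sum => t _.
  by have := no t; rewrite -leqNgt -sum1_card; exact: leq_trans.
set A := [pred i | ty i == t] in ht.
have N0 : 0 < N by apply: leq_ltn_trans big.
pose y x := nth (Ordinal N0) (enum A) x.
have sz x : x <= b -> x < size (enum A) by move=> xb; rewrite -cardE (leq_ltn_trans xb).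
exists t, y; split=> [x /sz h|x xb].
  by apply/eqP; have := mem_nth (Ordinal N0) h; rewrite mem_enum.
have := sorted_ltn_nth ltn_trans 0 (enum_ord_sorted A).
move=> /(_ x x.+1); rewrite !inE size_map => /(_ (sz _ (ltnW xb)) (sz _ xb) (leqnn _)).
by rewrite !(nth_map (Ordinal N0)) ?sz // ltnW.
Qed.

Lemma critical_copy k l m n (P : 'M[bool]_(k, l)) (M : 'M[bool]_(m, n)) i z :
  critical P M -> i < m -> z < n -> ent M i z = false ->
  exists f g r c, copy k l m n (ent P)
    (fun a b => ent M a b || (a == i) && (b == z)) f g r c.
Proof.
move=> [_ crit] im zn; rewrite (entE M (Ordinal im) (Ordinal zn)) => Mz.
have /NNPP/minor_copy[f [g [r [c [gr gc H]]]]] := crit _ _ Mz.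
exists f, g, r, c; split=> // a b /H[h1 h2 h3]; split=> //.
by have [i' [j' [-> ->]]] := entP h1; rewrite mxE entE.
Qed.

(** * Rows with many 0-runs *)

Section Bounded.

Variables (k l m n : nat) (P : 'M[bool]_(k, l)) (M : 'M[bool]_(m, n)).
Hypothesis mono : monotone_triples (ent P).
Hypothesis critM : critical P M.
Variables (i0 : 'I_m) (S : nat) (z o : nat -> nat).
Hypothesis Mz : forall t, t < S -> z t < n /\ ent M i0 (z t) = false.
Hypothesis Mo : forall t, 0 < t -> t < S -> ent M i0 (o t).
Hypothesis oz : forall t, 0 < t -> t < S -> o t < z t.
Hypothesis zo : forall t, t.+1 < S -> z t < o t.+1.

Lemma o_shift t d : 0 < t -> t + d < S -> o t + d <= o (t + d).
Proof.
move=> t0; elim: d => [|d IH]; first by rewrite !addn0.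
rewrite addnS => h; have := IH (ltnW h); have := zo h.
have := @oz (t + d) (ltn_addr d t0) (ltnW h).
by clear; lia.
Qed.

Lemma z_shift t d : t + d.+1 < S -> z t + d.+1 <= o (t + d.+1).
Proof.
move=> h; have h1 : t.+1 < S by clear -h; lia.
have := @o_shift t.+1 d isT; rewrite addSn -addnS => /(_ h).
by have := zo h1; clear; lia.
Qed.

(** A window of [a] indices holds [l] 1-entries at index distance [l] from each other and from both
    ends of the window. *)
Let a := l.+1 * l.
(** The type of a copy: the point sent to the flipped entry and one point off its row on either side
    of its column. *)
Notation T := (('I_k * 'I_l) * ('I_k * 'I_l) * ('I_k * 'I_l))%type.

(** Both blocker lemmas are applied around [z t]. The data form one tuple, type first, so that
    copies for many [t] can be chosen at once and sorted by type. *)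
Lemma typed_copy t : 0 < l -> a + a <= t -> t + a < S ->
  exists d : T * (nat -> nat -> nat) * (nat -> nat -> nat) * (nat -> nat) * (nat -> nat),
    let '((rho, gam), (rL, gL), (rR, gR), f, g, r, c) := d in
    [/\ P rho gam, P rL gL /\ P rR gR, rL != rho /\ rR != rho, gL < gam /\ gam < gR &
     [/\ f rho gam = i0, grid k m r, grid l n c,
        forall i j, ent P i j -> r i <= f i j < r i.+1 /\ c j <= g i j < c j.+1
      & [/\ forall i j, ent P i j -> i != rho \/ j != gam -> ent M (f i j) (g i j),
         o (t - a) < g rL gL & g rR gR < o (t + a)]]].
Proof.
move=> l0 at1 tS.
have a0 : l < a by rewrite /a mulSn -ltn_psubLR ?subnn ?muln_gt0 ?l0 //; clear -l0; lia.
have tS' : t < S by apply: leq_ltn_trans tS; apply: leq_addr.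
have [zn Mz0] := Mz tS'.
have [f [g [r [c Hc]]]] := critical_copy critM (ltn_ord i0) zn Mz0.
have pb i j : ent P i j -> i < k /\ j < l by exact: ent_bound.
have no_emb : ~ exists f g, emb k l m n (ent P) (ent M) f g.
  move=> [f' [g' E]]; apply: critM.1.
  (* A pattern without points would be contained in [M] by the cuts of the copy alone. *)
  have [x [y Pxy]] : exists x y, ent P x y.
    apply: NNPP => no; case: Hc => gr gc _; apply: critM.1; exists r, c.
    by split=> //; split=> // i j Pij; case: no; exists i, j; rewrite entE.
  exact: emb_minor Pxy E.
have [rho [gam [ps fs gs fq]]] := copy_center pb no_emb Hc.
have mul j : j < l -> l * j.+1 + l <= a.
  by move=> jl; rewrite -mulnSr /a mulnC leq_mul2r ltnS jl orbT.
have mul' j j' : j < j' -> l * j.+1 + l <= l * j'.+1.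
  by move=> jj; rewrite -mulnSr leq_mul2l ltnS jj orbT.
have ml j : l <= l * j.+1 by rewrite leq_pmulr.
have [rR [gR [pR nR gR1 gR2]]] : exists i j, [/\ ent P i j, i != rho, gam < j & g i j < o (t + a)].
  apply: (blocker_right pb no_emb Hc ps fs gs fq (o := fun j => o (t + l * j.+1))).
    move=> j jl; have h := mul j jl; have h1 := ml j.
    have tj : t + l * j.+1 < S by clear -h h1 tS; lia.
    split.
    - by apply: Mo => //; clear -at1 a0 l0; lia.
    - have := @z_shift t (l * j.+1).-1; rewrite prednK; last by clear -h1 l0; lia.
      by move=> /(_ tj); clear -h1; lia.
    - have := @o_shift (t + l * j.+1) (a - l * j.+1).
      have -> : t + l * j.+1 + (a - l * j.+1) = t + a by clear -h; lia.
      by move=> hh; have := hh ltac:(clear -at1 a0 l0; lia) tS; clear -h; lia.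
    - have := @o_shift (t + l * j.+1) (a - l * j.+1).
      have -> : t + l * j.+1 + (a - l * j.+1) = t + a by clear -h; lia.
      move=> hh; have := hh ltac:(clear -at1 a0 l0; lia) tS.
      have := @oz (t + a) ltac:(clear -at1 a0 l0; lia) tS; have [] := Mz tS.
      by clear -h; lia.
  move=> j j' jj' jl'; have h := mul' _ _ jj'; have h1 := mul j' jl'.
  have := @o_shift (t + l * j.+1) (l * j'.+1 - l * j.+1).
  have -> : t + l * j.+1 + (l * j'.+1 - l * j.+1) = t + l * j'.+1 by clear -h; lia.
  move=> hh; have := hh ltac:(clear -at1 a0 l0; lia) ltac:(clear -h1 tS; lia).
  by clear -h; lia.
have ta0 : 0 < t - a by clear -at1 a0 l0; lia.
have [rL [gL [pL nL gL1 gL2]]] : exists i j, [/\ ent P i j, i != rho, j < gam & o (t - a) < g i j].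
  apply: (blocker_left pb no_emb Hc ps fs gs fq (o := fun j => o (t - a + l * j.+1))).
    move=> j jl; have h := mul j jl; have h1 := ml j.
    have tj : t - a + l * j.+1 < S by clear -h h1 tS; lia.
    split.
    - by apply: Mo => //; clear -ta0; lia.
    - have := @o_shift (t - a + l * j.+1) (a - l * j.+1).
      have -> : t - a + l * j.+1 + (a - l * j.+1) = t by clear -h at1; lia.
      move=> hh; have := hh ltac:(clear -ta0; lia) tS'.
      by have := @oz t ltac:(clear -at1 a0 l0; lia) tS'; clear -h; lia.
    - by have := @o_shift (t - a) (l * j.+1) ta0 tj; clear -h1; lia.
    - have := @o_shift 1 (t - a + l * j.+1).-1 isT.
      have -> : 1 + (t - a + l * j.+1).-1 = t - a + l * j.+1 by clear -ta0; lia.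
      by move=> /(_ tj); clear -h1 ta0; lia.
  move=> j j' jj' jl'; have h := mul' _ _ jj'; have h1 := mul j' jl'.
  have := @o_shift (t - a + l * j.+1) (l * j'.+1 - l * j.+1).
  have -> : t - a + l * j.+1 + (l * j'.+1 - l * j.+1) = t - a + l * j'.+1 by clear -h; lia.
  move=> hh; have := hh ltac:(clear -ta0; lia) ltac:(clear -h1 tS; lia).
  by clear -h; lia.
have [gr gc Hrc] := Hc.
have [x1 [y1 [e1 e1' P1]]] := entP ps; have [x2 [y2 [e2 e2' P2]]] := entP pL.
have [x3 [y3 [e3 e3' P3]]] := entP pR; subst.
exists ((((x1, y1), (x2, y2), (x3, y3)), f, g, r, c)).
split=> //; split=> //; first by move=> i j /Hrc[_ h1 h2].
Qed.

(** Indices [3 * a] apart give each copy a window of [a] on both sides of its flipped entry and a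
    further window before it for the entries [O]. The pigeonhole principle yields [l.+1] copies of
    one type, and these glue to a copy of [P] in [M]. *)
Lemma few_runs : 0 < l -> S <= (3 * a) * (#|{: T}| * l).+3.
Proof.
move=> l0; rewrite leqNgt; apply/negP => big.
pose N := (#|{: T}| * l).+1.
pose t y := 3 * a * y.+1.
have tP (y : 'I_N) : a + a <= t y /\ t y + a < S.
  have : t y + 3 * a <= (3 * a) * (#|{: T}| * l).+3.
    by rewrite /t -mulnSr leq_mul2l; apply/orP; right; have := ltn_ord y; rewrite /N; clear; lia.
  have : 3 * a <= t y by rewrite /t leq_pmulr.
  by clear -big; lia.
have [d dP] := fin_all_exists (fun y : 'I_N => typed_copy l0 (tP y).1 (tP y).2).
have [ty [y [yT y_inc]]] := @pigeonhole_increasing _ N l (fun y => (d y).1.1.1.1) (leqnn _).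
case: ty yT => [[[rho gam] [rL gL]] [rR gR]] yT.
pose F x := (d (y x)).1.1.1.2; pose G x := (d (y x)).1.1.2.
pose R x := (d (y x)).1.2; pose C x := (d (y x)).2.
have dE x : x <= l ->
    [/\ P rho gam, P rL gL /\ P rR gR, rL != rho /\ rR != rho, gL < gam /\ gam < gR &
     [/\ F x rho gam = i0, grid k m (R x), grid l n (C x),
        forall i j, ent P i j -> R x i <= F x i j < R x i.+1 /\ C x j <= G x i j < C x j.+1
      & [/\ forall i j, ent P i j -> i != rho \/ j != gam -> ent M (F x i j) (G x i j),
         o (t (y x) - a) < G x rL gL & G x rR gR < o (t (y x) + a)]]].
  move=> xl; have := dP (y x); have := yT x xl; rewrite /F /G /R /C.
  by case: (d (y x)) => [[[[T0 f] g] r] c] /= ->.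
have [Ps [PL PR] [nL nR] [ltL ltR] _] := dE 0 (leq0n _).
have pb i j : ent P i j -> i < k /\ j < l by exact: ent_bound.
(* These indices lie after the window of copy [x.-1] and before that of copy [x]. *)
pose O x j := o (t (y x) - a - a + l * j.+1).
have mul j : j < l -> l * j.+1 + l <= a.
  by move=> jl; rewrite -mulnSr /a mulnC leq_mul2r ltnS jl orbT.
have mul' j j' : j < j' -> l * j.+1 + l <= l * j'.+1.
  by move=> jj; rewrite -mulnSr leq_mul2l ltnS jj orbT.
have ml j : l <= l * j.+1 by rewrite leq_pmulr.
have a0 : 0 < a by rewrite /a muln_gt0.
have t3 x : 3 * a <= t (y x) by rewrite /t leq_pmulr.
have t_inc x : x < l -> t (y x) + 3 * a <= t (y x.+1).
  by move=> xl; rewrite /t -mulnSr leq_mul2l ltnS y_inc ?orbT.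
have [f [g E]] : exists f g, emb k l m n (ent P) (ent M) f g.
  apply: (@family_emb k l m n _ _ pb mono i0 rho gam rL gL rR gR
    _ _ _ _ _ _ _ F G R O); rewrite ?entE //.
  - by move=> x /dE[_ _ _ _ []].
  - by move=> x i j /dE[_ _ _ _ [_ _ _ _ [h _ _]]]; exact: h.
  - move=> x i j /dE[_ _ _ _ [_ gr _ H _]] pij; have [ik _] := pb _ _ pij.
    by have [h _] := H _ _ pij; exact: grid_bound gr ik h.
  - move=> x i j /dE[_ _ _ _ [_ _ gc H _]] pij; have [_ jl] := pb _ _ pij.
    by have [_ h] := H _ _ pij; exact: grid_bound gc jl h.
  - move=> x i j u /dE[_ _ _ _ [_ gr _ H _]] pij; have [ik _] := pb _ _ pij.
    by have [h _] := H _ _ pij; exact: grid_cut gr ik h.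
  - move=> x i j i' j' /dE[_ _ _ _ [_ _ gc H _]] pij pij'.
    have [_ jl] := pb _ _ pij; have [_ jl'] := pb _ _ pij'.
    by have [_ h] := H _ _ pij; have [_ h'] := H _ _ pij'; exact: grid_incr gc jl h jl' h'.
  - move=> x j xl jl; have [h1 h2] := tP (y x); apply: Mo.
      by have := ml j; clear -l0; lia.
    by have := mul j jl; have := t3 x; clear -h2; lia.
  - move=> x j xl jl; have [h1 h2] := tP (y x).
    have := @o_shift 1 (t (y x) - a - a + l * j.+1).-1 isT.
    have -> : 1 + (t (y x) - a - a + l * j.+1).-1 = t (y x) - a - a + l * j.+1.
      by have := ml j; clear -l0; lia.
    move=> hh; have := hh ltac:(have := mul j jl; have := t3 x; clear -h2; lia).
    by rewrite /O; have := ml j; have := t3 x; clear -l0 a0; lia.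
  - move=> x j j' xl jj' jl'; have [h1 h2] := tP (y x); have h := mul' _ _ jj'.
    have := @o_shift (t (y x) - a - a + l * j.+1) (l * j'.+1 - l * j.+1).
    have -> : t (y x) - a - a + l * j.+1 + (l * j'.+1 - l * j.+1) = t (y x) - a - a + l * j'.+1.
      by clear -h; lia.
    move=> hh; have := hh ltac:(have := t3 x; clear -a0; lia)
      ltac:(have := mul j' jl'; have := t3 x; clear -h2; lia).
    by rewrite /O; clear -h; lia.
  - move=> x j xl jl; have [h1 h2] := tP (y x); have h := mul _ jl.
    have [_ _ _ _ [_ _ _ _ [_ hL _]]] := dE x xl.
    have := @o_shift (t (y x) - a - a + l * j.+1) (a - l * j.+1).
    have -> : t (y x) - a - a + l * j.+1 + (a - l * j.+1) = t (y x) - a.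
      by have := t3 x; clear -h; lia.
    move=> hh; have := hh ltac:(have := t3 x; clear -a0; lia) ltac:(clear -h2; lia).
    by rewrite /O; clear -h hL; lia.
  - move=> x j xl jl; have [h1 h2] := tP (y x); have h := mul _ jl.
    have [h1' h2'] := tP (y x.+1); have ti := t_inc x xl.
    have [_ _ _ _ [_ _ _ _ [_ _ hR]]] := dE x (ltnW xl).
    have := @o_shift (t (y x) + a) (t (y x.+1) - a - a + l * j.+1 - (t (y x) + a)).
    have -> : t (y x) + a + (t (y x.+1) - a - a + l * j.+1 - (t (y x) + a)) =
       t (y x.+1) - a - a + l * j.+1 by clear -ti; lia.
    move=> hh; have := hh ltac:(clear -a0; lia) ltac:(clear -h2' h a0; lia).
    by rewrite /O; have := ml j; clear -h hR ti; lia.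
have Pe : ent P rho gam by rewrite entE.
by apply: critM.1; apply: emb_minor Pe E.
Qed.

End Bounded.

Lemma monotone_row_bounded k l (P : 'M[bool]_(k, l)) :
  monotone_triples (ent P) -> row_bounded P.
Proof.
move=> mono.
exists (3 * (l.+1 * l) * (#|{: ('I_k * 'I_l) * ('I_k * 'I_l) * ('I_k * 'I_l)}| * l).+3).
move=> m n M critM i.
case: (posnP l) => [l0|l0].
  (* For a pattern without columns, the copy created by filling a 0-entry would force [n = 0]. *)
  rewrite (_ : row_complexity M i = 0) //; apply/eqP; rewrite cards_eq0 -subset0.
  apply/subsetP => j; rewrite inE => /andP[/negbTE /(critM.2 _ _) /NNPP H _].
  case: H => _ [c [_ [[c0 cl _] _]]]; exfalso; have n0 : n = 0 by rewrite -cl l0.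
  by have := ltn_ord j; rewrite {2}n0.
rewrite /row_complexity; set A := [set j | _].
pose s := [seq val j | j <- enum A].
have sz : size s = #|A| by rewrite size_map -cardE.
rewrite -sz.
have sA t : t < size s -> exists2 j : 'I_n, j \in A & nth 0 s t = j.
  move=> ts; have : nth 0 s t \in s by apply: mem_nth.
  by move=> /mapP[j]; rewrite mem_enum => jA ->; exists j.
have s_inc t : t.+1 < size s -> nth 0 s t < nth 0 s t.+1.
  move=> h; apply: (sorted_ltn_nth ltn_trans 0 (enum_ord_sorted (mem A))) => //.
  exact: ltnW.
have pos t : 0 < t -> t < size s -> 0 < nth 0 s t.
  by case: t => // t _ h; apply: leq_ltn_trans (s_inc t h).
have Mo t : 0 < t -> t < size s -> ent M i (nth 0 s t).-1.
  move=> t0 ts; have := pos t t0 ts; have [j + E] := sA t ts; rewrite E inE => /andP[_].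
  move=> /orP[/eqP /= ->//|/existsP[j' /andP[/eqP /= <-]]] Mj _.
  by rewrite entE.
have Mz t : t < size s -> nth 0 s t < n /\ ent M i (nth 0 s t) = false.
  by move=> /sA[j + ->]; rewrite inE ltn_ord entE => /andP[/negbTE -> _].
(* [z t] is the first column of a 0-run; for [t > 0] the entry before it is a 1-entry, which
   separates the run from the previous one. *)
apply: (few_runs mono critM (z := nth 0 s) (o := fun t => (nth 0 s t).-1) (i0 := i)) => //.
- by move=> t t0 ts; have := pos t t0 ts; clear; lia.
- move=> t ts /=; have h := s_inc t ts; have h2 := Mo t.+1 isT ts.
  have [_ h3] := Mz t (ltnW ts).
  rewrite ltn_neqAle; apply/andP; split; last by clear -h; lia.
  by apply/eqP => E; move: h2; rewrite -E h3.
Qed.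

(** * Unbounded patterns *)

Lemma interval_minor_mono k l m n (P : 'M[bool]_(k, l)) (M M' : 'M[bool]_(m, n)) :
  (forall i j, M i j -> M' i j) -> interval_minor P M -> interval_minor P M'.
Proof.
move=> MM [r [c [gr [gc H]]]]; exists r, c; split=> //; split=> // i j /H.
by move=> [a [b [h1 h2 h3]]]; exists a, b; split=> //; exact: MM.
Qed.

(** 1-entries are added as long as [P] stays avoided; the number of 0-entries decreases. *)
Lemma critical_above k l m n (P : 'M[bool]_(k, l)) (M : 'M[bool]_(m, n)) :
  avoids P M -> exists2 M' : 'M[bool]_(m, n),
    critical P M' & forall i j, M i j -> M' i j.
Proof.
move: {2}(#|_|) (leqnn #|[set t | ~~ M t.1 t.2]|) => d.
elim: d M => [|d IH] M hd av.
  exists M => //; split=> // a b Mab; exfalso.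
  move: hd; rewrite leqn0 cards_eq0 => /eqP/setP/(_ (a, b)).
  by rewrite !inE /= Mab.
have [cr|ncr] := classic (critical P M); first by exists M.
have [a [b [Mab av']]] : exists a b, M a b = false /\ avoids P (set_one M a b).
  apply: NNPP => no; apply: ncr; split=> // a b Mab av'.
  by apply: no; exists a, b.
have [|M' cM' le'] := IH (set_one M a b) _ av'.
  rewrite -ltnS; apply: leq_trans hd; apply: proper_card; apply/properP; split.
    by apply/subsetP => t; rewrite !inE mxE negb_or => /andP[].
  by exists (a, b); rewrite !inE ?mxE /= ?Mab // !eqxx orbT.
by exists M' => // i j Mij; apply: le'; rewrite mxE Mij.
Qed.

(* The entries [e x] stay 0 in every critical matrix above [M], and the 1-entries
   next to them keep them in different 0-runs. *)
Definition spiked k l (P : 'M[bool]_(k, l)) (N : nat) : Prop :=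
  exists m n (M : 'M[bool]_(m, n)) (i : 'I_m) (e : 'I_N -> 'I_n),
    [/\ avoids P M, injective e & forall x,
      [/\ exists2 j, M i j & (val j).+1 = e x, exists2 j, M i j & val j = (e x).+1
        & interval_minor P (set_one M i (e x))]].

Lemma spiked_unbounded k l (P : 'M[bool]_(k, l)) :
  (forall N, spiked P N.+1) -> ~ row_bounded P.
Proof.
move=> sp [B HB]; have [m [n [M [i [e [av inj eP]]]]]] := sp B.
have [M' cM' le] := critical_above av.
have := HB _ _ _ cM' i; rewrite leqNgt => /negP; apply.
rewrite /row_complexity -[B.+1]card_ord -(card_imset _ inj).
apply: subset_leq_card; apply/subsetP => _ /imsetP[x _ ->].
have [[j Mj je] _ mi] := eP x; rewrite inE; apply/andP; split.
  apply/negP => Me; apply: cM'.1; apply: interval_minor_mono mi => a b.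
  by rewrite mxE => /orP[/le //|/andP[/eqP-> /eqP->]].
by apply/orP; right; apply/existsP; exists j; rewrite /= -je /= eqxx; exact: le.
Qed.

(** * Reflections *)

Definition flip_cols m n (M : 'M[bool]_(m, n)) : 'M[bool]_(m, n) :=
  \matrix_(i, j) M i (rev_ord j).
Definition flip_rows m n (M : 'M[bool]_(m, n)) : 'M[bool]_(m, n) :=
  \matrix_(i, j) M (rev_ord i) j.

Lemma flip_colsK m n : involutive (@flip_cols m n).
Proof. by move=> M; apply/matrixP => i j; rewrite !mxE rev_ordK. Qed.

Lemma flip_rowsK m n : involutive (@flip_rows m n).
Proof. by move=> M; apply/matrixP => i j; rewrite !mxE rev_ordK. Qed.

Lemma grid_rev k m r : grid k m r -> grid k m (fun i => m - r (k - i)).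
Proof.
move=> gr; have [r0 rk rS] := gr; split; rewrite ?subn0 ?subnn ?rk ?r0 ?subnn ?subn0 //.
move=> i ik; have := rS (k - i.+1); have -> : (k - i.+1).+1 = k - i by clear -ik; lia.
have := grid_gap gr (leq_subr i k) (leqnn k); rewrite rk.
by have := leq_subr i.+1 k; clear -ik; lia.
Qed.

Lemma grid_rev_block k m r (i : 'I_k) (a : 'I_m) : grid k m r ->
  r (rev_ord i) <= a < r (rev_ord i).+1 ->
  m - r (k - i) <= rev_ord a < m - r (k - i.+1).
Proof.
move=> gr /= /andP[h1 h2]; have ik := ltn_ord i; have am := ltn_ord a.
have E : (k - i.+1).+1 = k - i by clear -ik; lia.
by move: h1 h2; rewrite E; clear -am; lia.
Qed.

Lemma interval_minor_flip_cols k l m n (P : 'M[bool]_(k, l)) (M : 'M[bool]_(m, n)) :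
  interval_minor P M -> interval_minor (flip_cols P) (flip_cols M).
Proof.
move=> [r [c [gr [gc H]]]]; exists r, (fun j => n - c (l - j)).
split=> //; split; first exact: grid_rev.
move=> i j; rewrite mxE => /H[a [b [h1 h2 h3]]].
exists a, (rev_ord b); rewrite mxE rev_ordK; split=> //.
exact: grid_rev_block.
Qed.

Lemma interval_minor_flip_rows k l m n (P : 'M[bool]_(k, l)) (M : 'M[bool]_(m, n)) :
  interval_minor P M -> interval_minor (flip_rows P) (flip_rows M).
Proof.
move=> [r [c [gr [gc H]]]]; exists (fun i => m - r (k - i)), c.
split; first exact: grid_rev.
split=> // i j; rewrite mxE => /H[a [b [h1 h2 h3]]].
exists (rev_ord a), b; rewrite mxE rev_ordK; split=> //.
exact: grid_rev_block.
Qed.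

(** Reflection exchanges the left and right neighbours of a spike, which is why [spiked] asks for
    1-entries on both sides. *)
Lemma spiked_flip_cols k l (P : 'M[bool]_(k, l)) N :
  spiked (flip_cols P) N -> spiked P N.
Proof.
move=> [m [n [M [i [e [av inj eP]]]]]].
exists m, n, (flip_cols M), i, (fun x => rev_ord (e x)); split.
- by move=> /interval_minor_flip_cols; rewrite flip_colsK.
- by move=> x y /rev_ord_inj /inj.
move=> x; have [[j1 M1 E1] [j2 M2 E2] mi] := eP x; split.
- exists (rev_ord j2); rewrite ?mxE ?rev_ordK //=.
  by have := ltn_ord j2; rewrite (E2 : (j2 : nat) = _); clear; lia.
- exists (rev_ord j1); rewrite ?mxE ?rev_ordK //=.
  by have := ltn_ord (e x); rewrite -(E1 : _ = (e x : nat)) /=; clear; lia.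
have -> : set_one (flip_cols M) i (rev_ord (e x)) = flip_cols (set_one M i (e x)).
  by apply/matrixP => a b; rewrite !mxE (can2_eq rev_ordK rev_ordK).
by rewrite -[P]flip_colsK; exact: interval_minor_flip_cols.
Qed.

Lemma spiked_flip_rows k l (P : 'M[bool]_(k, l)) N :
  spiked (flip_rows P) N -> spiked P N.
Proof.
move=> [m [n [M [i [e [av inj eP]]]]]].
exists m, n, (flip_rows M), (rev_ord i), e; split=> //.
  by move=> /interval_minor_flip_rows; rewrite flip_rowsK.
move=> x; have [[j1 M1 E1] [j2 M2 E2] mi] := eP x; split.
- by exists j1; rewrite ?mxE ?rev_ordK.
- by exists j2; rewrite ?mxE ?rev_ordK.
have -> : set_one (flip_rows M) (rev_ord i) (e x) = flip_rows (set_one M i (e x)).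
  by apply/matrixP => a b; rewrite !mxE (can2_eq rev_ordK rev_ordK).
by rewrite -[P]flip_rowsK; exact: interval_minor_flip_rows.
Qed.

Lemma ent_mx m n (F : nat -> nat -> bool) i j :
  ent (\matrix_(a < m, b < n) F a b) i j = [&& i < m, j < n & F i j].
Proof.
rewrite /ent; case: insubP => [a -> <-|/negbTE -> //].
by case: insubP => [b -> <-|/negbTE -> //]; rewrite mxE.
Qed.

(** * The staircase matrix for [Q1] *)

Section Staircase.

Variables (k l : nat) (P : 'M[bool]_(k, l)).
Variables (ra ca rb cb rc cc : nat).
Hypotheses (Pa : ent P ra ca) (Pb : ent P rb cb) (Pc : ent P rc cc).
Hypotheses (ab : ra < rb) (bc : rb < rc) (ba : cb < ca) (ac : ca < cc).
Variable N : nat.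

Let h := rc - ra.
Let w := (cc - cb).+1.

Let inner i j :=
  [&& ra <= i, i < ra.+1 + N.+1 * h, cb <= j & j < cb + N.+1 * w].

(* Row [ra] misses the column of [a] in each block of columns; the block with
   index [x] from the left carries, in the block of rows with index [N - x] from
   the top, a copy of the rows of [P] from [ra.+1] to [rc]. All other entries,
   outside the rows and columns of this staircase, are 1. *)
Let stairs i j := inner i j ==>
  if i == ra then (j - cb) %% w != ca - cb
  else ((j - cb) %/ w + (i - ra.+1) %/ h == N) &&
       ent P (ra.+1 + (i - ra.+1) %% h) (cb + (j - cb) %% w).

Let m := k + N * h.
Let n := l + N * w.
Let M : 'M[bool]_(m, n) := \matrix_(i, j) stairs i j.

Let spike x := ca + x * w.

Let rows_lt : ra < k /\ rc < k.
Proof. by have [? _] := ent_bound Pa; have [? _] := ent_bound Pc. Qed.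

Let cols_lt : cc < l.
Proof. by have [_ ?] := ent_bound Pc. Qed.

Let h_gt0 : 0 < h.
Proof. by rewrite subn_gt0 (ltn_trans ab). Qed.

Lemma stairs_avoid : avoids P M.
Proof.
move=> /minor_copy[f [g [r [c [gr gc H]]]]].
have [qa fa ga] := H _ _ Pa; have [qb fb gb] := H _ _ Pb; have [qc fc gc'] := H _ _ Pc.
have [ka la] := ent_bound Pa; have [kb lb] := ent_bound Pb; have [kc lc] := ent_bound Pc.
have f1 := grid_incr gr ka fa kb fb ab; have f2 := grid_incr gr kb fb kc fc bc.
have g1 := grid_incr gc lb gb la ga ba; have g2 := grid_incr gc la ga lc gc' ac.
have [fa0 _] := grid_bound gr ka fa; have [_ fc1] := grid_bound gr kc fc.
have [gb0 _] := grid_bound gc lb gb; have [_ gc1] := grid_bound gc lc gc'.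
have f3 := grid_incr gr ka fa kc fc (ltn_trans ab bc).
move: (f ra ca) (f rb cb) (f rc cc) (g ra ca) (g rb cb) (g rc cc) qa qb qc
  f1 f2 g1 g2 fa0 fc1 gb0 gc1 f3 => fA fB fC gA gB gC {fa ga fb gb fc gc'} qa qb qc
  f1 f2 g1 g2 fa0 fc1 gb0 gc1 f3.
move: qa qb qc; rewrite !ent_mx => /and3P[_ _ sa] /and3P[_ _ sb] /and3P[_ _ sc].
have Eh : N.+1 * h = h + N * h by rewrite mulSn.
have Ew : N.+1 * w = w + N * w by rewrite mulSn.
(* The rows and columns of [P] around the three points need room too, which confines the three
   images to [inner]. *)
have fin : fC < ra.+1 + N.+1 * h by rewrite Eh; move: fc1; rewrite /m /h; clear -ab bc; lia.
have gin : gC < cb + N.+1 * w by rewrite Ew; move: gc1; rewrite /n /w; clear -ba ac; lia.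
have inn i j : ra <= i -> i <= fC -> cb <= j -> j <= gC -> inner i j.
  move=> i1 i2 j1 j2; rewrite /inner i1 j1 (leq_ltn_trans i2 fin).
  exact: leq_ltn_trans gin.
have w0 : 0 < w by [].
have low i j : inner i j -> ra < i -> stairs i j -> (j - cb) %/ w + (i - ra.+1) %/ h = N.
  by move=> ij ri; rewrite /stairs ij gtn_eqF //= => /andP[/eqP].
have nB := low fB gB ltac:(apply: inn; clear -f1 f2 g1 g2 fa0 gb0 ab bc ba ac; lia)
  ltac:(clear -f1 fa0 ab; lia) sb.
have nC := low fC gC ltac:(apply: inn; clear -f1 f2 g1 g2 fa0 gb0 ab bc ba ac; lia)
  ltac:(clear -f1 f2 fa0 ab bc; lia) sc.
have iA : inner fA gA by apply: inn; clear -f1 f2 g1 g2 fa0 gb0 ab bc ba ac; lia.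
have dx : (gB - cb) %/ w <= (gC - cb) %/ w by apply: leq_div2r; clear -g1 g2 ba ac; lia.
have dy : (fB - ra.+1) %/ h <= (fC - ra.+1) %/ h by apply: leq_div2r; clear -f1 f2 ab bc; lia.
(* The block indices of [b] and [c] have the same sum [N] and both weakly increase from [b] to [c],
   so they coincide. *)
have Ex : (gC - cb) %/ w = (gB - cb) %/ w.
  move: nB nC dx dy; move: (_ %/ _) (_ %/ _) (_ %/ _) (_ %/ _) => b1 b2 b3 b4.
  by clear; lia.
have := divn_eq (gB - cb) w; have := divn_eq (gC - cb) w; rewrite Ex.
have := ltn_pmod (gC - cb) w0; set x := (gB - cb) %/ w => hm eC eB.
(* The images of [b] and [c] are at least [cc - cb = w.-1] columns apart, so they fill the block
   from end to end and leave one column for [a]. *)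
have EA : gA - cb = x * w + (ca - cb).
  have Ew1 : w = (cc - cb).+1 by [].
  move: hm eC eB Ew1; move: w (x * w) (_ %% _) (_ %% _) => w' xw mB mC.
  by clear -g1 g2 gb0 ba ac; lia.
have mA : (gA - cb) %% w = ca - cb.
  by rewrite EA modnMDl modn_small // /w; clear -ba ac; lia.
(* In row [ra] the entry in this column is missing. Below it, the image of [a] would share a block
   with that of [c], but the [h] rows of a block cannot hold two rows at distance at least
   [rc - ra = h]. *)
case: (ltngtP ra fA) fa0 => // [rf _|rf _]; last first.
  by move: sa; rewrite /stairs iA -rf eqxx mA eqxx.
have nA := low _ _ iA rf sa.
have xA : (gA - cb) %/ w = x.
  by rewrite EA divnMDl // divn_small ?addn0 // /w; clear -ba ac; lia.
have yAC : (fA - ra.+1) %/ h = (fC - ra.+1) %/ h.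
  rewrite xA in nA; rewrite Ex -/x in nC; clear -nA nC; clearbody x; move: nA nC.
  move: (_ %/ _) (_ %/ _) => b1 b2.
  by clear; lia.
have := divn_eq (fA - ra.+1) h; have := divn_eq (fC - ra.+1) h; rewrite yAC.
have Eh1 : h = rc - ra by [].
have := ltn_pmod (fC - ra.+1) h_gt0.
move: Eh1; move: h (_ %/ _ * h) (_ %% _) (_ %% _) => h' yh mA' mC.
by clear -f3 rf ab bc; lia.
Qed.

Lemma spike_lt (x : 'I_N.+1) : spike x < n.
Proof.
have : x * w <= N * w by rewrite leq_mul2r -ltnS ltn_ord orbT.
by rewrite /spike /n; have := cols_lt; clear -ac; lia.
Qed.

Lemma ra_lt : ra < m.
Proof. by rewrite /m; have [hh _] := rows_lt; apply: leq_trans hh (leq_addr _ _). Qed.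

Let i0 : 'I_m := Ordinal ra_lt.
Let e (x : 'I_N.+1) : 'I_n := Ordinal (spike_lt x).

Lemma spike_ent (M' : 'M[bool]_(m, n)) x a b :
  M' = set_one M i0 (e x) -> ent M' a b = 
  [&& a < m, b < n & stairs a b || ((a == ra) && (b == spike x))].
Proof.
move=> ->; rewrite /ent; case: insubP => [i -> <-|/negbTE -> //].
by case: insubP => [j -> <-|/negbTE -> //]; rewrite !mxE.
Qed.

(** The rows from [ra.+1] to [rc] and the columns from [cb] to [cc] go to the block with index [x];
    later rows and columns are shifted past the staircase, where all entries are 1. The only entry
    lacking is the spike. *)
Lemma stairs_spike (x : 'I_N.+1) : interval_minor P (set_one M i0 (e x)).
Proof.
have xN : x <= N by rewrite -ltnS ltn_ord.
pose f i := if i <= ra then i else if i <= rc then i + (N - x) * h else i + N * h.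
pose g j := if j < cb then j else if j <= cc then j + x * w else j + N * w.
have hx : (N - x) * h <= N * h by rewrite leq_mul2r leq_subr orbT.
have wx : x * w <= N * w by rewrite leq_mul2r xN orbT.
have fb i : i <= f i /\ f i <= i + N * h.
  rewrite /f; move: hx; move: (_ * h) (_ * h) => hx hN.
  by case: ifP => _; [|case: ifP => _]; clear; lia.
have gb j : j <= g j /\ g j <= j + N * w.
  rewrite /g; move: wx; move: (_ * w) (_ * w) => wx wN.
  by case: ifP => _; [|case: ifP => _]; clear; lia.
apply: (emb_minor Pa (f := fun i _ => f i) (g := fun _ j => g j)) => i j pij.
have [ik jl] := ent_bound pij; have [f1 f2] := fb i; have [g1 g2] := gb j; split; last first.
  move=> i' j' _; rewrite /f /g; split=> hlt.
    move: hx hlt; move: (_ * h) (_ * h) => hx hN.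
    by case: (leqP i ra) => a1; case: (leqP i' ra) => a2; case: (leqP i rc) => a3;
      case: (leqP i' rc) => a4; clear -a1 a2 a3 a4; lia.
  move: wx hlt; move: (_ * w) (_ * w) => wx wN.
  by case: (ltnP j cb) => a1; case: (ltnP j' cb) => a2; case: (leqP j cc) => a3;
    case: (leqP j' cc) => a4; clear -a1 a2 a3 a4; lia.
split; last 2 first.
- by split=> //; rewrite /m; clear -f2; lia.
- by split=> //; rewrite /n; clear -g2; lia.
rewrite (spike_ent _ _ (erefl _)); apply/and3P; split.
- by rewrite /m; clear -f2 ik; lia.
- by rewrite /n; clear -g2 jl; lia.
have Eh : N.+1 * h = h + N * h by rewrite mulSn.
have Ew : N.+1 * w = w + N * w by rewrite mulSn.
rewrite /stairs; case: (boolP (inner _ _)) => //=.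
move=> /and4P[i1 i2 j1 j2].
have ri : ra <= i by move: i1; rewrite /f; case: (leqP i ra) => [_|/ltnW].
have irc : i <= rc.
  rewrite leqNgt; apply/negP => hh; move: i2; rewrite /f Eh.
  have Eh1 : h = rc - ra by [].
  move: Eh1; move: h (_ * h) (_ * h) => h' h1 h2.
  by case: (leqP i ra) => c1; case: (leqP i rc) => c2; clear -hh ab bc c1 c2; lia.
have cbj : cb <= j by move: j1; rewrite /g; case: ltnP => //; clear; lia.
have jcc : j <= cc.
  rewrite leqNgt; apply/negP => hh; move: j2; rewrite /g Ew.
  have Ew1 : w = (cc - cb).+1 by [].
  move: Ew1; move: w (_ * w) (_ * w) => w' w1 w2.
  by case: (ltnP j cb) => c1; case: (leqP j cc) => c2; clear -hh ba ac c1 c2 cbj; lia.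
have gE : g j - cb = x * w + (j - cb).
  by rewrite /g ltnNge cbj jcc /=; move: (_ * w) => xw; clear -cbj; lia.
have jw : j - cb < w by rewrite /w; clear -jcc; lia.
case: (ltngtP ra i) ri => // [ri _|<- _].
  have fE : f i - ra.+1 = (N - x) * h + (i - ra.+1).
    by rewrite /f leqNgt ri irc /=; move: (_ * h) => yh; clear -ri; lia.
  have ih : i - ra.+1 < h by rewrite /h; clear -irc ri; lia.
  have -> : (f i == ra) = false by rewrite gtn_eqF // (leq_trans ri).
  rewrite gE fE !divnMDl // !modnMDl !divn_small // !modn_small // !addn0.
  by rewrite !subnKC // eqxx pij.
have -> : f ra = ra by rewrite /f leqnn.
rewrite eqxx /= gE modnMDl modn_small //.
case: (eqVneq j ca) => [->|jca]; last by apply/orP; left; clear -jca cbj ba; lia.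
by apply/orP; right; rewrite /g /spike ltnNge (ltnW ba) (ltnW ac) /= eqxx.
Qed.

Lemma stairs_spiked : spiked P N.+1.
Proof.
exists m, n, M, i0, e; split; first exact: stairs_avoid.
  move=> x y /(congr1 val) /= /eqP; rewrite /spike eqn_add2l eqn_mul2r /=.
  by move=> /eqP /val_inj.
(* As [cb < ca < cc], a spike is neither first nor last in its block of columns, so its neighbours
   are 1-entries. *)
move=> x; have nb j : j < n -> (j - cb) %% w != ca - cb -> exists2 j' : 'I_n, M i0 j' & val j' = j.
  move=> jn hj; exists (Ordinal jn) => //; rewrite mxE /stairs /= eqxx.
  by apply/implyP.
have xn := spike_lt x; have xN : x <= N by rewrite -ltnS ltn_ord.
have wx : x * w <= N * w by rewrite leq_mul2r xN orbT.
split; last exact: stairs_spike.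
- have [||j Mj jE] := nb (spike x).-1.
  + by apply: leq_ltn_trans xn; exact: leq_pred.
  + have -> : (spike x).-1 - cb = x * w + (ca - cb).-1 by rewrite /spike; clear -ba; lia.
    by rewrite modnMDl modn_small /w; clear -ba ac; lia.
  by exists j => //; rewrite /= jE /spike; clear -ba; lia.
- have [||j Mj jE] := nb (spike x).+1.
  + by rewrite /spike /n; have := cols_lt; clear -wx ac; lia.
  + have -> : (spike x).+1 - cb = x * w + (ca - cb).+1 by rewrite /spike; clear -ba; lia.
    by rewrite modnMDl modn_small /w; clear -ba ac; lia.
  by exists j.
Qed.

End Staircase.

(** * Three-point patterns and their reflections *)

Lemma perm3_points k l (P : 'M[bool]_(k, l)) (s0 s1 s2 : 'I_3) :
  interval_minor (perm3 s0 s1 s2) P ->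
  exists i0 j0 i1 j1 i2 j2, [/\ ent P i0 j0, ent P i1 j1, ent P i2 j2, i0 < i1 < i2 &
    [/\ (s0 < s1 -> j0 < j1) /\ (s1 < s0 -> j1 < j0),
        (s1 < s2 -> j1 < j2) /\ (s2 < s1 -> j2 < j1) &
        (s0 < s2 -> j0 < j2) /\ (s2 < s0 -> j2 < j0)]].
Proof.
move=> [r [c [[r0 rk rS] [gc H]]]].
have r1 := rS 1 isT; have r2 := rS 2 isT.
have [|a0 [b0 [/andP[? A0] B0 P0]]] := H ord0 s0; first by rewrite mxE /= eqxx.
have [|a1 [b1 [/andP[A1 A1'] B1 P1]]] := H (@Ordinal 3 1 isT) s1; first by rewrite mxE /= eqxx.
have [|a2 [b2 [/andP[A2 ?] B2 P2]]] := H (@Ordinal 3 2 isT) s2; first by rewrite mxE /= eqxx.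
exists a0, b0, a1, b1, a2, b2; rewrite !entE; split=> //.
  by apply/andP; split; [exact: leq_trans A0 A1 | exact: leq_trans A1' A2].
have K (s s' : 'I_3) b b' : c s <= b < c s.+1 -> c s' <= b' < c s'.+1 -> s < s' -> b < b'.
  move=> hb hb' ss; have := grid_incr gc (ltn_ord s) hb (ltn_ord s') hb' ss.
  by clear -ss; lia.
split; split.
- exact: (K _ _ _ _ B0 B1).
- exact: (K _ _ _ _ B1 B0).
- exact: (K _ _ _ _ B1 B2).
- exact: (K _ _ _ _ B2 B1).
- exact: (K _ _ _ _ B0 B2).
- exact: (K _ _ _ _ B2 B0).
Qed.

(** Here [v] lists the three columns from left to right; the cuts are made at [i1], [i2] and at
    [v 1], [v 2]. *)
Lemma perm3_minor k l (P : 'M[bool]_(k, l)) (s0 s1 s2 : nat) i0 i1 i2 (v : nat -> nat) :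
  s0 < 3 -> s1 < 3 -> s2 < 3 -> i0 < i1 -> i1 < i2 -> v 0 < v 1 -> v 1 < v 2 -> v 2 < l ->
  ent P i0 (v s0) -> ent P i1 (v s1) -> ent P i2 (v s2) ->
  interval_minor (perm3 s0 s1 s2) P.
Proof.
move=> h0 h1 h2 i01 i12 v01 v12 v2 p0 p1 p2.
pose r i := if i is i'.+1 then if i' is i''.+1 then if i'' is _.+1 then k else i2 else i1 else 0.
pose c j := if j is j'.+1 then if j' is j''.+1 then if j'' is _.+1 then l else v 2 else v 1 else 0.
have [ik _] := ent_bound p2.
have cP s : s < 3 -> c s <= v s < c s.+1.
  by case: s => [|[|[|]]] //= _; rewrite ?leqnn ?leq0n ?v01 ?v12 ?v2.
exists r, c; split; first split=> //.
  by case=> [|[|[|]]] //= _; apply: leq_trans i01.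
split; first split=> //.
  by case=> [|[|[|]]] //= _; apply: leq_ltn_trans v01.
move=> i j; rewrite mxE => /or3P[] /andP[/eqP /= -> /eqP /= ->].
- have [a [b [aE bE Pab]]] := entP p0; exists a, b; rewrite -bE cP //= -aE i01.
  by split.
- have [a [b [aE bE Pab]]] := entP p1; exists a, b; rewrite -bE cP //= -aE leqnn i12.
  by split.
- have [a [b [aE bE Pab]]] := entP p2; exists a, b; rewrite -bE cP //= -aE leqnn ik.
  by split.
Qed.

Lemma avoids_monotone_triples k l (P : 'M[bool]_(k, l)) :
  ~ interval_minor Q1 P -> ~ interval_minor Q2 P ->
  ~ interval_minor Q3 P -> ~ interval_minor Q4 P -> monotone_triples (ent P).
Proof.
move=> n1 n2 n3 n4 i0 j0 i1 j1 i2 j2 p0 p1 p2 i01 i12 d01 d12 d02.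
have [_ l0] := ent_bound p0; have [_ l1] := ent_bound p1; have [_ l2] := ent_bound p2.
pose v a b c t := if t is t'.+1 then if t' is _.+1 then c else b else a : nat.
case: (ltngtP j0 j1) d01 => // h01 _; case: (ltngtP j1 j2) d12 => // h12 _;
case: (ltngtP j0 j2) d02 => // h02 _; try (by left); try (by right); try (exfalso; clear -h01 h12 h02; lia).
- by case: n3; apply: (@perm3_minor _ _ _ _ _ _ i0 i1 i2 (v j0 j2 j1)).
- by case: n2; apply: (@perm3_minor _ _ _ _ _ _ i0 i1 i2 (v j2 j0 j1)).
- by case: n1; apply: (@perm3_minor _ _ _ _ _ _ i0 i1 i2 (v j1 j0 j2)).
- by case: n4; apply: (@perm3_minor _ _ _ _ _ _ i0 i1 i2 (v j1 j2 j0)).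
Qed.

Lemma ent_flip_rows k l (P : 'M[bool]_(k, l)) i j :
  ent P i j -> ent (flip_rows P) (k - i.+1) j.
Proof.
by move=> /entP[i' [j' [-> -> Pij]]]; rewrite (entE _ (rev_ord i') j') mxE rev_ordK.
Qed.

Lemma minor_Q1_spiked k l (P : 'M[bool]_(k, l)) N :
  interval_minor Q1 P -> spiked P N.+1.
Proof.
move=> /(@perm3_points _ _ _ (@Ordinal 3 1 isT) (@Ordinal 3 0 isT) (@Ordinal 3 2 isT)).
move=> [i0 [j0 [i1 [j1 [i2 [j2 [p0 p1 p2 /andP[i01 i12]]]]]]]].
move=> [[_ /(_ isT) h1] _ [/(_ isT) h2 _]].
exact: (stairs_spiked p0 p1 p2).
Qed.

(** Reversing the rows turns [Q4] into [Q1], with the points taken from bottom to top. *)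
Lemma minor_Q4_spiked k l (P : 'M[bool]_(k, l)) N :
  interval_minor Q4 P -> spiked P N.+1.
Proof.
move=> /(@perm3_points _ _ _ (@Ordinal 3 2 isT) (@Ordinal 3 0 isT) (@Ordinal 3 1 isT)).
move=> [i0 [j0 [i1 [j1 [i2 [j2 [p0 p1 p2 /andP[i01 i12]]]]]]]].
move=> [_ [/(_ isT) h1 _] [_ /(_ isT) h2]]; apply: spiked_flip_rows.
have [ik _] := ent_bound p2.
apply: (stairs_spiked (ent_flip_rows p2) (ent_flip_rows p1) (ent_flip_rows p0)) => //;
  clear -i01 i12 ik; lia.
Qed.

Lemma flip_cols_perm3 (s0 s1 s2 : 'I_3) :
  flip_cols (perm3 s0 s1 s2) = perm3 (2 - s0) (2 - s1) (2 - s2).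
Proof.
apply/matrixP => i j; rewrite !mxE.
have E (s : 'I_3) : (val (rev_ord j) == s) = (val j == 2 - s).
  by have := ltn_ord s; have := ltn_ord j; rewrite /=; clear; lia.
by rewrite !E.
Qed.

(** Reversing the columns turns [Q2] into [Q1] and, in the next lemma, [Q3] into [Q4]. *)
Lemma minor_Q2_spiked k l (P : 'M[bool]_(k, l)) N :
  interval_minor Q2 P -> spiked P N.+1.
Proof.
move=> /interval_minor_flip_cols.
rewrite (flip_cols_perm3 (@Ordinal 3 1 isT) (@Ordinal 3 2 isT) (@Ordinal 3 0 isT)).
by move=> /minor_Q1_spiked/spiked_flip_cols.
Qed.

Lemma minor_Q3_spiked k l (P : 'M[bool]_(k, l)) N :
  interval_minor Q3 P -> spiked P N.+1.
Proof.
move=> /interval_minor_flip_cols.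
rewrite (flip_cols_perm3 (@Ordinal 3 0 isT) (@Ordinal 3 2 isT) (@Ordinal 3 1 isT)).
by move=> /minor_Q4_spiked/spiked_flip_cols.
Qed.

Theorem theorem3p1 (k l : nat) (P : 'M[bool]_(k, l)) :
  row_bounded P <->
  [/\ ~ interval_minor Q1 P, ~ interval_minor Q2 P,
      ~ interval_minor Q3 P & ~ interval_minor Q4 P].
Proof.
split=> [bd|[n1 n2 n3 n4]]; last exact/monotone_row_bounded/avoids_monotone_triples.
have no Q : (forall N, Q -> spiked P N.+1) -> ~ Q.
  by move=> sp q; apply: (spiked_unbounded _ bd) => N; apply: sp.
split; apply: no => N.
- exact: minor_Q1_spiked.
- exact: minor_Q2_spiked.
- exact: minor_Q3_spiked.
- exact: minor_Q4_spiked.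
Qed.
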